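(* Let $((R_\lambda)_{\lambda\in\Omega},(\phi_{\mu,\lambda})_{\mu\ge\lambda})$ be a direct system of dense, left normal rings. Then $$\lim \mathrm{SCu}(R_\lambda)\cong \mathrm{SCu}(\lim R_\lambda),$$ where the limit on the left is taken in the category $\mathrm{SCu}$ and the limit on the right in the category of rings.
   Context: Rings are associative and not necessarily unital. $M_\infty(R)$ is the ring of infinite matrices over $R$ with finitely many nonzero entries. For $x,y\in M_\infty(R)$, $x\precsim_1 y$ means $x=syt$ for some $s,t\in M_\infty(R)$. $x\oplus y$ denotes the infinite matrix represented by the block diagonal matrix $\mathrm{diag}(x,y)$, where $x,y$ are replaced by finite square upper-left corners containing all their nonzero entries. $T(R)=\{(x_n)_{n\ge1}: x_n\in M_\infty(R),\ x_n\precsim_1 x_{n+1}\ \forall n\}$, and $\mathcal S(R)=\{(x_n)\in T(R): \forall n\ \exists y_{n+1}\in M_\infty(R),\ x_n=y_{n+1}x_{n+1}x_n\}$. For $(x_n),(y_n)\in T(R)$ write $(x_n)\precsim(y_n)$ if for every $n$ there is $m$ with $x_n\precsim_1 y_m$, and $(x_n)\sim(y_n)$ if $(x_n)\precsim (y_n)$ and $(y_n)\precsim(x_n)$. Put $\Lambda(R)=T(R)/{\sim}$ and $\mathrm S(R)=\mathcal S(R)/{\sim}\subseteq\Lambda(R)$, with the order induced by $\precsim$ and addition $[(x_n)]+[(y_n)]=[(x_n\oplus y_n)]$; these are positively ordered commutative monoids. A ring homomorphism $\phi\colon R\to R'$ induces $\Lambda(\phi)\colon\Lambda(R)\to\Lambda(R')$,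 $[(x_n)]\mapsto[(\phi(x_n))]$, which maps $\mathrm S(R)$ into $\mathrm S(R')$. $R$ is dense if whenever $x\precsim_1 y$ in $M_\infty(R)$ there is $z\in M_\infty(R)$ with $x\precsim_1 z\precsim_1 y$. $R$ is left normal if for all $a,b,c\in M_\infty(R)$ with $a=ba$ and $b=cb$ there exist $d,e\in M_\infty(R)$ with $a=da$, $d=ed$, $e=ce$. In a partially ordered set where increasing sequences have suprema, $x\ll y$ means: for every increasing sequence $(z_n)$ with $y\le\sup_n z_n$ there is $m$ with $x\le z_m$. A $\mathrm{Cu}$-semigroup is a positively ordered monoid $S$ satisfying: (O1) increasing sequences have suprema; (O2) every element is the supremum of a sequence $(x_n)$ with $x_n\ll x_{n+1}$ for all $n$; (O3) $x'\ll x$, $y'\ll y$ imply $x'+y'\ll x+y$; (O4) $\sup_n(x_n+y_n)=\sup_n x_n+\sup_n y_n$ for increasing sequences. $\mathrm{Cu}$-morphisms are the monoid maps preserving order, $\ll$ and suprema of increasing sequences. A sequence $(x_n)$ in $S$ is weakly increasing if there is an increasing sequence $(y_m)$ in $S$ such that for every $m$ there is $n(m)$ with $y_m\le x_n$ for all $n\ge n(m)$, and $x_n\le \sup_m y_m$ for every $n$ (then $\sup_n x_n=\sup_m y_m$ exists). The category $\mathrm{SCu}$ has as objects pairs $(S,W)$ with $S$ a $\mathrm{Cu}$-semigroup and $W$ a submonoid of $S$ such that the supremum of any sequence in $W$ that is weakly increasing in $S$ belongs to $W$; morphisms $(S_1,W_1)\to(S_2,W_2)$ are $\mathrm{Cu}$-morphisms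 $f\colon S_1\to S_2$ with $f(W_1)\subseteq W_2$. $\mathrm{SCu}$ admits direct limits. For a dense ring $R$, $\mathrm{SCu}(R)=(\Lambda(R),\mathrm S(R))$ is an object of $\mathrm{SCu}$, and $\mathrm{SCu}(\phi)=\Lambda(\phi)$ for a homomorphism $\phi$ between dense rings. *)

(* Defs.v *)
From HB Require Import structures.
From mathcomp Require Import all_boot all_order ssralg ssrnum.
From mathcomp Require Import generic_quotient zify.
From mathcomp Require Import boolp classical_sets cardinality.

Set Implicit Arguments.
Unset Strict Implicit.
Unset Printing Implicit Defensive.

Import Order.TTheory GRing.Theory Num.Theory.

Local Open Scope quotient_scope.
Local Open Scope classical_set_scope.
Local Open Scope ring_scope.

HB.mixin Record Zmodule_isRng R of GRing.Zmodule R := {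
  rmul : R -> R -> R;
  rmulA : associative rmul;
  rmulDl : left_distributive rmul +%R;
  rmulDr : right_distributive rmul +%R
}.

#[short(type="rngType")]
HB.structure Definition Rng := {R of Zmodule_isRng R & GRing.Zmodule R}.

Notation "x ** y" := (rmul x y) (at level 40, left associativity) : ring_scope.

Record rngHom (R R' : rngType) := RngHom {
  rng_fun :> {additive R -> R'};
  rng_funM : {morph rng_fun : x y / x ** y}
}.

Section RngTheory.
Variable R : rngType.
Implicit Types x y : R.

Lemma rmul0l y : 0 ** y = 0.
Proof. by apply: (addrI (0 ** y)); rewrite -rmulDl !addr0. Qed.

Lemma rmul0r x : x ** 0 = 0.
Proof. by apply: (addrI (x ** 0)); rewrite -rmulDr !addr0. Qed.

Lemma rmul_suml I (r : seq I) (P : pred I) (F : I -> R) y :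
  (\sum_(i <- r | P i) F i) ** y = \sum_(i <- r | P i) F i ** y.
Proof.
apply: (big_morph (fun x => x ** y)); last exact: rmul0l.
by move=> a b; rewrite rmulDl.
Qed.

Lemma rmul_sumr I (r : seq I) (P : pred I) (F : I -> R) x :
  x ** (\sum_(i <- r | P i) F i) = \sum_(i <- r | P i) x ** F i.
Proof.
apply: (big_morph (fun y => x ** y)); last exact: rmul0r.
by move=> a b; rewrite rmulDr.
Qed.

End RngTheory.

Record mxinf (R : nmodType) := MxInf {
  mxinf_fun :> nat -> nat -> R;
  mxinf_fin : finite_set [set ij : nat * nat | mxinf_fun ij.1 ij.2 != 0]
}.

Section MxInfCorner.
Variable R : nmodType.
Implicit Types x y : mxinf R.

Lemma mxinfP x y : (forall i j, x i j = y i j) -> x = y.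
Proof.
case: x y => [f fP] [g gP] /= efg.
have e : f = g by apply/funext => i; apply/funext => j.
by case: _ / e gP => gP; congr MxInf; exact: Prop_irrelevance.
Qed.

Lemma finite_cornerP (f : nat -> nat -> R) :
  finite_set [set ij : nat * nat | f ij.1 ij.2 != 0] <->
  exists n, forall i j, (n <= i)%N || (n <= j)%N -> f i j = 0.
Proof.
split=> [/finite_seqP[s sE]|[n fn]].
  exists (\max_(ij <- s) maxn ij.1 ij.2).+1 => i j nij.
  apply/eqP; apply: contraT => fij0.
  have ijs : (i, j) \in s by have : [set` s] (i, j) by rewrite -sE.
  have := leq_bigmax_seq (P := xpredT) (F := fun ij => maxn ij.1 ij.2) _ ijs isT.
  rewrite geq_max /= => /andP[le_i le_j]; move: nij.
  by rewrite !ltnNge le_i le_j.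
apply: (@sub_finite_set _ _ (`I_n `*` `I_n)); last first.
  by apply: finite_setX; exact: finite_II.
move=> [i j] /= fij0; split=> /=; rewrite ltnNge; apply: contra fij0 => le_n.
  by rewrite fn ?le_n.
by rewrite fn ?le_n ?orbT.
Qed.

Definition mxinf_of (f : nat -> nat -> R)
    (fP : exists n, forall i j, (n <= i)%N || (n <= j)%N -> f i j = 0) :=
  MxInf (proj2 (finite_cornerP f) fP).

Lemma corner_ex x :
  exists n, `[< forall i j, (n <= i)%N || (n <= j)%N -> x i j = 0 >].
Proof. by have [n xn] := proj1 (finite_cornerP x) (mxinf_fin x); exists n; apply/asboolP. Qed.

(* size of the least upper-left corner containing all nonzero entries *)
Definition corner x : nat := ex_minn (corner_ex x).

Lemma cornerP x i j : (corner x <= i)%N || (corner x <= j)%N -> x i j = 0.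
Proof. by rewrite /corner; case: ex_minnP => n /asboolP xn _; apply: xn. Qed.

Lemma cornerPl x i j : (corner x <= i)%N -> x i j = 0.
Proof. by move=> le_n; rewrite cornerP ?le_n. Qed.

Lemma cornerPr x i j : (corner x <= j)%N -> x i j = 0.
Proof. by move=> le_n; rewrite cornerP ?le_n ?orbT. Qed.

Lemma corner_min x n :
  (forall i j, (n <= i)%N || (n <= j)%N -> x i j = 0) -> (corner x <= n)%N.
Proof.
by move=> xn; rewrite /corner; case: ex_minnP => m _; apply; apply/asboolP.
Qed.

Lemma mxinf0_fin : exists n, forall i j,
  (n <= i)%N || (n <= j)%N -> (fun _ _ : nat => 0 : R) i j = 0.
Proof. by exists 0%N. Qed.

Definition mxinf0 : mxinf R := mxinf_of mxinf0_fin.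

Lemma osum_fin x y : exists n, forall i j, (n <= i)%N || (n <= j)%N ->
  (fun i j => if (i < corner x)%N && (j < corner x)%N then x i j
    else if (corner x <= i)%N && (corner x <= j)%N
         then y (i - corner x)%N (j - corner x)%N else 0) i j = 0.
Proof.
exists (corner x + corner y)%N => i j nij /=; case: ifP => [_|_].
  apply: cornerP; apply/orP; move: nij.
  by case/orP=> /(leq_trans (leq_addr _ _)) ->; [left|right].
case: ifP => // /andP[xi xj]; apply: cornerP; rewrite !leq_subRL //.
Qed.

(* diag(x, y), with x cut to its least corner; any larger corner gives the    *)
(* same class in Lambda below                                                 *)
Definition osum x y : mxinf R := mxinf_of (osum_fin x y).

End MxInfCorner.

Notation "x (+) y" := (osum x y) : ring_scope.

Section MxInfMul.
Variable R : rngType.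
Implicit Types x y z : mxinf R.

Lemma mxinf_mul_fin x y : exists n, forall i j, (n <= i)%N || (n <= j)%N ->
  (fun i j => \sum_(k < corner x) x i k ** y k j) i j = 0.
Proof.
exists (maxn (corner x) (corner y)) => i j; rewrite !geq_max => nij.
apply: big1 => k _; case/orP: nij => /andP[le_x le_y].
  by rewrite cornerPl ?rmul0l.
by rewrite [y _ _]cornerPr ?rmul0r.
Qed.

(* columns of x beyond its corner vanish, so this is the full product *)
Definition mxinf_mul x y : mxinf R := mxinf_of (mxinf_mul_fin x y).

End MxInfMul.

Notation "x *i y" := (mxinf_mul x y) (at level 40, left associativity) : ring_scope.

Section MxInfMulTheory.
Variable R : rngType.
Implicit Types x y z : mxinf R.

Lemma mxinf_mulE n x y i j : (corner x <= n)%N ->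
  (x *i y) i j = \sum_(k < n) x i k ** y k j.
Proof.
move=> le_n; rewrite /= (big_ord_widen n (fun k => x i k ** y k j) le_n).
rewrite big_mkcond; apply: eq_bigr => k _; case: ifPn => //.
by rewrite -leqNgt => le_k; rewrite cornerPr ?rmul0l.
Qed.

Lemma mxinf_mulA x y z : x *i (y *i z) = x *i y *i z.
Proof.
apply: mxinfP => i j.
rewrite (@mxinf_mulE (corner x)) //.
rewrite (@mxinf_mulE (maxn (corner (x *i y)) (corner y)) (x *i y)) ?leq_maxl //.
under eq_bigr => k _.
  rewrite (@mxinf_mulE (maxn (corner (x *i y)) (corner y))) ?leq_maxr //.
  rewrite rmul_sumr.
  over.
rewrite exchange_big; apply: eq_bigr => k _ /=.
by rewrite rmul_suml; apply: eq_bigr => l _; rewrite rmulA.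
Qed.

Definition lesim1 x y := exists s t, x = s *i y *i t.

Lemma lesim1_trans y x z : lesim1 x y -> lesim1 y z -> lesim1 x z.
Proof.
move=> [s [t ->]] [u [v ->]]; exists (s *i u), (v *i t).
by rewrite !mxinf_mulA.
Qed.

Lemma lesim1_0 y : lesim1 (mxinf0 R) y.
Proof.
exists (mxinf0 R), (mxinf0 R); apply: mxinfP => i j.
by rewrite /= big1 // => k _; rewrite rmul0r.
Qed.

End MxInfMulTheory.

Section BlockDiagonal.
Variables (R : rngType) (I : finType).
Implicit Types (c d e : nat -> I) (oc od oe : I -> nat) (x y s t : I -> mxinf R).

Lemma bdiag_fin c oc d od x : exists n, forall i j, (n <= i)%N || (n <= j)%N ->
  (fun i j => if c i == d j
    then x (c i) (i - oc (c i))%N (j - od (c i))%N else 0) i j = 0.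
Proof.
exists (\sum_a (corner (x a) + oc a + od a))%N => i j nij /=.
case: ifP => // _; move: (c i) => a; apply: cornerP; move: nij.
rewrite (bigD1 a) //=.
move: (\sum_(_ | _) _)%N => m nij.
by move: nij; lia.
Qed.

(* Blocks x a indexed by a : I; the row i lies in the block c i, at position   *)
(* i - oc (c i) inside that block, and likewise for columns with d and od.     *)
Definition bdiag c oc d od x : mxinf R := mxinf_of (bdiag_fin c oc d od x).

Lemma bdiag_mul c oc d od e oe x y :
  (forall k, (od (d k) <= k)%N) ->
  (forall a r, d (od a + r)%N != a -> forall p q, x a p r ** y a r q = 0) ->
  bdiag c oc d od x *i bdiag d od e oe y = bdiag c oc e oe (fun a => x a *i y a).
Proof.
move=> dP cov; apply: mxinfP => i j; set a := c i.
set K := maxn (corner (x a)) (corner (bdiag c oc d od x)).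
rewrite (@mxinf_mulE _ (od a + K)%N); last first.
  by rewrite (leq_trans _ (leq_addl _ _)) // leq_maxr.
rewrite /= -/a; case: ifPn => [/eqP ea|nea]; last first.
  apply: big1 => k _; case: (a =P d k) => [adk|_]; last by rewrite rmul0l.
  by rewrite -adk (negPf nea) rmul0r.
rewrite -[RHS]/((x a *i y a) (i - oc a)%N (j - oe a)%N).
rewrite (@mxinf_mulE _ K) ?leq_maxl //.
rewrite big_split_ord /= big1 ?add0r => [|k _]; last first.
  case: (a =P d k) => [adk|_]; last by rewrite rmul0l.
  by have := dP k; rewrite -adk leqNgt ltn_ord.
apply: eq_bigr => r _; rewrite addKn.
case: (a =P d (od a + r)%N) => [adk|/eqP]; first by rewrite -adk -ea eqxx addKn.
by rewrite eq_sym => /cov ->; rewrite rmul0l.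
Qed.

Lemma bdiag_lesim1 c oc d od x y :
  (forall k, (od (d k) <= k)%N) ->
  (forall a r, d (od a + r)%N != a ->
     (forall q, y a r q = 0) /\ (forall p, y a p r = 0)) ->
  (forall a, lesim1 (x a) (y a)) ->
  lesim1 (bdiag c oc c oc x) (bdiag d od d od y).
Proof.
move=> dP cov /choice[s /choice[t xE]].
exists (bdiag c oc d od s), (bdiag d od c oc t).
rewrite bdiag_mul // => [|a r /cov[y0 _] p q]; last by rewrite y0 rmul0r.
rewrite bdiag_mul // => [|a r /cov[_ y0] p q]; last first.
  by rewrite (_ : (_ *i _) _ _ = 0) ?rmul0l //= big1 // => k _; rewrite y0 rmul0r.
by congr bdiag; apply/funext.
Qed.

End BlockDiagonal.

Section OsumTheory.
Variable R : rngType.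
Implicit Types x y z : mxinf R.

Lemma osumE x y : x (+) y =
  let n := corner x in
  let o := (fun b : bool => if b then n else 0%N) in
  bdiag (leq n) o (leq n) o (fun b => if b then y else x).
Proof.
apply: mxinfP => i j /=; rewrite !ltnNge.
by case: (leqP _ i); case: (leqP _ j) => //=; rewrite !subn0.
Qed.

Lemma osum_lesim1 x x' y y' :
  lesim1 x x' -> lesim1 y y' -> lesim1 (x (+) y) (x' (+) y').
Proof.
move=> xx' yy'; rewrite !osumE; apply: bdiag_lesim1 => [k|[] r|[]] //=.
- by case: ifP.
- by rewrite leq_addr eqxx.
- by rewrite add0n eqbF_neg negbK => le_r; split=> q;
    [exact: cornerPl|exact: cornerPr].
Qed.

Lemma osumC_lesim1 x x' y y' :
  lesim1 x x' -> lesim1 y y' -> lesim1 (x (+) y) (y' (+) x').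
Proof.
move=> xx' yy'; rewrite !osumE /=.
have -> : bdiag (leq (corner x)) (fun b : bool => if b then corner x else 0%N)
    (leq (corner x)) (fun b : bool => if b then corner x else 0%N)
    (fun b : bool => if b then y else x) =
  bdiag (fun k => ~~ (leq (corner x) k))
    (fun b : bool => if b then 0%N else corner x)
    (fun k => ~~ (leq (corner x) k))
    (fun b : bool => if b then 0%N else corner x)
    (fun b : bool => if b then x else y).
  by apply: mxinfP => i j /=; rewrite (inj_eq negb_inj); case: (leqP _ i).
apply: bdiag_lesim1 => [k|[] r|[]] //=.
- by case: ifP.
- by rewrite leq_addr eqxx.
- by rewrite add0n eqbF_neg negbK => le_r; split=> q;
    [exact: cornerPl|exact: cornerPr].
Qed.

Let blocks3 x y z (a : option bool) : mxinf R :=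
  if a is Some b then if b then z else y else x.

Lemma osumAr x y z :
  let n := corner x in let m := corner y in
  let d := (fun k => if (k < n)%N then None else Some (m <= k - n)%N) in
  let od := (fun a => if a is Some b then if b then (n + m)%N else n else 0%N) in
  x (+) (y (+) z) = bdiag d od d od (blocks3 x y z).
Proof.
apply: mxinfP => i j /=; rewrite !(leqNgt (corner x)).
case: (ltnP i (corner x)); case: (ltnP j (corner x)) => //= xj xi.
  by rewrite !subn0.
rewrite (inj_eq Some_inj) !ltnNge.
by case: (leqP (corner y) (i - _)); case: (leqP (corner y) (j - _)) => //= _ _;
  rewrite -!subnDA.
Qed.

Lemma osumAl x y z :
  let n := corner x in let m := corner (x (+) y) in
  let d := (fun k => if (m <= k)%N then Some true
                     else if (n <= k)%N then Some false else None) in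
  let od := (fun a => if a is Some b then if b then m else n else 0%N) in
  x (+) y (+) z = bdiag d od d od (blocks3 x y z).
Proof.
apply: mxinfP => i j /=; rewrite !(ltnNge _ (corner (x (+) y))).
set m := corner (x (+) y).
case: (leqP m i); case: (leqP m j) => //= mj mi.
- by case: leqP.
- by case: leqP.
- rewrite !ltnNge; case: (leqP _ i); case: (leqP _ j) => //= _ _.
  by rewrite !subn0.
Qed.

Lemma osumA_lesim1 x x' y y' z z' :
  lesim1 x x' -> lesim1 y y' -> lesim1 z z' ->
  lesim1 (x (+) y (+) z) (x' (+) (y' (+) z')).
Proof.
move=> xx' yy' zz'; rewrite osumAl osumAr.
apply: bdiag_lesim1 => [k|a r|[[]|]] //=.
- by case: ifP => // /negbT; rewrite -leqNgt => nk; case: ifP => // mk; lia.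
- case: a => [[]|] /=.
  + by rewrite ifN -?leqNgt -?addnA ?leq_addr// addKn leq_addr.
  + rewrite ifN -?leqNgt ?leq_addr// addKn; case: (leqP (corner y') r) => // le_r _.
    by split=> q; [exact: cornerPl|exact: cornerPr].
  + rewrite add0n; case: ltnP => // le_r _.
    by split=> q; [exact: cornerPl|exact: cornerPr].
Qed.

Lemma osumA_lesim1' x x' y y' z z' :
  lesim1 x x' -> lesim1 y y' -> lesim1 z z' ->
  lesim1 (x (+) (y (+) z)) (x' (+) y' (+) z').
Proof.
move=> xx' yy' zz'; rewrite osumAr osumAl.
have xle : (corner x' <= corner (x' (+) y'))%N.
  apply: corner_min => i j le_ij.
  case: (ltnP i (corner x')) => [xi|]; last exact: cornerPl.
  case: (ltnP j (corner x')) => [xj|]; last exact: cornerPr.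
  by have := cornerP le_ij; rewrite /= xi xj.
have yle r q : (corner (x' (+) y') <= corner x' + r)%N -> y' r q = 0 /\ y' q r = 0.
  move=> le_r; split.
    have := @cornerPl _ (x' (+) y') _ (corner x' + q)%N le_r.
    by rewrite /= !ltnNge !leq_addr /= !addKn.
  have := @cornerPr _ (x' (+) y') (corner x' + q)%N _ le_r.
  by rewrite /= !ltnNge !leq_addr /= !addKn.
apply: bdiag_lesim1 => [k|a r|[[]|]] //=.
- by do 2?case: ifP.
- case: a => [[]|] /=.
  + by rewrite leq_addr.
  + by case: ifP => [le_r _|]; [split=> q; have [] := yle _ q le_r|rewrite leq_addr].
  + rewrite add0n; case: (leqP (corner x') r) => [le_r _|lt_r].
      by split=> q; [exact: cornerPl|exact: cornerPr].
    by rewrite leqNgt (leq_trans lt_r xle).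
Qed.

Lemma osum0l x : mxinf0 R (+) x = x.
Proof.
have c0 : corner (mxinf0 R) = 0%N by apply/eqP; rewrite -leqn0; apply: corner_min.
by apply: mxinfP => i j /=; rewrite c0 /= !subn0.
Qed.

End OsumTheory.

(* sequences are indexed from 0 *)
Record tseq (R : rngType) := TSeq {
  tseq_fun :> nat -> mxinf R;
  tseq_lesim1 : forall n, lesim1 (tseq_fun n) (tseq_fun n.+1)
}.

HB.instance Definition _ (R : rngType) := gen_eqMixin (tseq R).
HB.instance Definition _ (R : rngType) := gen_choiceMixin (tseq R).

Section TSeq.
Variable R : rngType.
Implicit Types x y z : tseq R.

Definition calS : set (tseq R) :=
  [set x : tseq R | forall n, exists y : mxinf R, x n = y *i x n.+1 *i x n].

Definition lesim x y := forall n, exists m, lesim1 (x n) (y m).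

Definition sim x y := lesim x y /\ lesim y x.

Lemma tseq_lt x n m : (n < m)%N -> lesim1 (x n) (x m).
Proof.
elim: m => // m IHm; rewrite ltnS leq_eqVlt => /predU1P[->|/IHm le_nm].
  exact: tseq_lesim1.
exact: lesim1_trans le_nm (tseq_lesim1 x m).
Qed.

Lemma tseq_le x a n m : (n <= m)%N -> lesim1 a (x n) -> lesim1 a (x m).
Proof.
rewrite leq_eqVlt => /predU1P[->//|/(tseq_lt x) le_nm le_an].
exact: lesim1_trans le_an le_nm.
Qed.

Lemma lesim_refl x : lesim x x.
Proof. by move=> n; exists n.+1; exact: tseq_lesim1. Qed.

Lemma lesim_trans y x z : lesim x y -> lesim y z -> lesim x z.
Proof.
move=> xy yz n; have [m xym] := xy n; have [k yzk] := yz m.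
by exists k; exact: lesim1_trans xym yzk.
Qed.

Definition simb x y : bool := `[< sim x y >].

Lemma simb_refl : reflexive simb.
Proof. by move=> x; apply/asboolP; split; exact: lesim_refl. Qed.

Lemma simb_sym : symmetric simb.
Proof. by move=> x y; apply/asboolP/asboolP => -[]. Qed.

Lemma simb_trans : transitive simb.
Proof.
move=> y x z /asboolP[xy yx] /asboolP[yz zy]; apply/asboolP; split.
  exact: lesim_trans xy yz.
exact: lesim_trans zy yx.
Qed.

Definition sim_equiv := EquivRel simb simb_refl simb_sym simb_trans.

Definition tseq0 : tseq R := @TSeq R (fun=> mxinf0 R) (fun=> lesim1_0 _).

Definition tseq_osum x y : tseq R := @TSeq R (fun n => x n (+) y n)
  (fun n => osum_lesim1 (tseq_lesim1 x n) (tseq_lesim1 y n)).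

End TSeq.

Definition Lambda (R : rngType) := {eq_quot (sim_equiv R)}.
HB.instance Definition _ (R : rngType) := Choice.on (Lambda R).
HB.instance Definition _ (R : rngType) := EqQuotient.on (Lambda R).

(* Positively ordered commutative monoids. The order is a field of the record *)
(* because mathcomp has no structure joining nmodType with porderType below   *)
(* porderZmodType, where only the trivial monoid is positively ordered.       *)
Record pomonType := POMonoid {
  pom_sort :> nmodType;
  pom_le : pom_sort -> pom_sort -> Prop;
  pom_refl : forall x, pom_le x x;
  pom_anti : forall x y, pom_le x y -> pom_le y x -> x = y;
  pom_trans : forall y x z, pom_le x y -> pom_le y z -> pom_le x z;
  pom_ge0 : forall x, pom_le 0 x;
  pom_leD : forall x y x' y',
    pom_le x x' -> pom_le y y' -> pom_le (x + y) (x' + y')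
}.

Notation "x <=p y" := (pom_le x y) (at level 70, no associativity) : ring_scope.

Section LambdaPOMonoid.
Variable R : rngType.
Implicit Types (x y z : tseq R) (u v w : Lambda R).

Local Notation cl x := (\pi_(Lambda R) x).

Lemma Lambda_eqP x y : reflect (cl x = cl y) `[< sim x y >].
Proof. exact: (@eqmodP _ (sim_equiv R)). Qed.

Lemma Lambda_reprP x : sim (repr (cl x)) x.
Proof. by apply/asboolP/Lambda_eqP; rewrite reprK. Qed.

Definition Lambda_le u v := lesim (repr u) (repr v).

Lemma Lambda_leE x y : Lambda_le (cl x) (cl y) <-> lesim x y.
Proof.
have [xr rx] := Lambda_reprP x; have [yr ry] := Lambda_reprP y; split=> h.
  exact: lesim_trans (lesim_trans rx h) yr.
exact: lesim_trans (lesim_trans xr h) ry.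
Qed.

Lemma Lambda_le_refl u : Lambda_le u u.
Proof. exact: lesim_refl. Qed.

Lemma Lambda_le_anti u v : Lambda_le u v -> Lambda_le v u -> u = v.
Proof.
by move=> uv vu; rewrite -[u]reprK -[v]reprK; apply/Lambda_eqP/asboolP.
Qed.

Lemma Lambda_le_trans v u w : Lambda_le u v -> Lambda_le v w -> Lambda_le u w.
Proof. exact: lesim_trans. Qed.

Definition Lambda_zero : Lambda R := cl (tseq0 R).

Definition Lambda_add u v : Lambda R := cl (tseq_osum (repr u) (repr v)).

Lemma tseq_osum_lesim x x' y y' :
  lesim x x' -> lesim y y' -> lesim (tseq_osum x y) (tseq_osum x' y').
Proof.
move=> xx' yy' n; have [m xm] := xx' n; have [k yk] := yy' n.
exists (maxn m k); apply: osum_lesim1.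
  exact: tseq_le (leq_maxl _ _) xm.
exact: tseq_le (leq_maxr _ _) yk.
Qed.

Lemma Lambda_addE x y : Lambda_add (cl x) (cl y) = cl (tseq_osum x y).
Proof.
apply/Lambda_eqP/asboolP; have [xr rx] := Lambda_reprP x.
by have [yr ry] := Lambda_reprP y; split; apply: tseq_osum_lesim.
Qed.

Lemma Lambda_addC : commutative Lambda_add.
Proof.
move=> u v; apply/Lambda_eqP/asboolP.
by split=> n; exists n.+1; apply: osumC_lesim1; exact: tseq_lesim1.
Qed.

Lemma Lambda_addA : associative Lambda_add.
Proof.
move=> u v w; elim/quotW: u => x; elim/quotW: v => y; elim/quotW: w => z.
rewrite (Lambda_addE y z) (Lambda_addE x y) (Lambda_addE x) (Lambda_addE _ z).
apply/Lambda_eqP/asboolP; split=> n; exists n.+1.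
  by apply: osumA_lesim1'; exact: tseq_lesim1.
by apply: osumA_lesim1; exact: tseq_lesim1.
Qed.

Lemma Lambda_add0 : left_id Lambda_zero Lambda_add.
Proof.
elim/quotW=> x; rewrite (Lambda_addE (tseq0 R) x).
apply/Lambda_eqP/asboolP; split=> n; exists n.+1 => /=; rewrite osum0l;
  exact: tseq_lesim1.
Qed.

HB.instance Definition _ := GRing.isNmodule.Build (Lambda R)
  Lambda_addA Lambda_addC Lambda_add0.

Lemma Lambda_ge0 u : Lambda_le 0 u.
Proof.
by elim/quotW: u => x; apply/Lambda_leE => n; exists 0%N; exact: lesim1_0.
Qed.

Lemma Lambda_leD u v u' v' :
  Lambda_le u u' -> Lambda_le v v' -> Lambda_le (u + v) (u' + v').
Proof. by move=> uu' vv'; apply/Lambda_leE; exact: tseq_osum_lesim. Qed.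

Definition Lambda_pomon : pomonType := @POMonoid (Lambda R) Lambda_le
  Lambda_le_refl Lambda_le_anti Lambda_le_trans Lambda_ge0 Lambda_leD.

Lemma le_pi x y : @pom_le Lambda_pomon (cl x) (cl y) <-> lesim x y.
Proof. exact: Lambda_leE. Qed.

Lemma add_pi x y : cl x + cl y = cl (tseq_osum x y).
Proof. exact: Lambda_addE. Qed.

Definition LambdaS : set (Lambda R) := [set \pi_(Lambda R) x | x in calS (R := R)].

End LambdaPOMonoid.

Section LambdaMap.
Variables (R R' : rngType) (phi : rngHom R R').

Lemma mxinf_map_fin (x : mxinf R) : exists n, forall i j,
  (n <= i)%N || (n <= j)%N -> (fun i j => phi (x i j)) i j = 0.
Proof. by exists (corner x) => i j /cornerP ->; rewrite raddf0. Qed.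

Definition mxinf_map (x : mxinf R) : mxinf R' := mxinf_of (mxinf_map_fin x).

Lemma mxinf_mapM : {morph mxinf_map : x y / x *i y}.
Proof.
move=> x y; apply: mxinfP => i j; rewrite (@mxinf_mulE _ (corner x)); last first.
  by apply: corner_min => k l /cornerP /= ->; rewrite raddf0.
by rewrite /= raddf_sum; apply: eq_bigr => k _; rewrite rng_funM.
Qed.

Lemma mxinf_map_lesim1 x y : lesim1 x y -> lesim1 (mxinf_map x) (mxinf_map y).
Proof.
by move=> [s [t ->]]; exists (mxinf_map s), (mxinf_map t); rewrite -!mxinf_mapM.
Qed.

Definition tseq_map (x : tseq R) : tseq R' :=
  @TSeq R' (fun n => mxinf_map (x n)) (fun n => mxinf_map_lesim1 (tseq_lesim1 x n)).

Definition Lambda_map (u : Lambda R) : Lambda R' :=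
  \pi_(Lambda R') (tseq_map (repr u)).

Lemma Lambda_mapE x :
  Lambda_map (\pi_(Lambda R) x) = \pi_(Lambda R') (tseq_map x).
Proof.
apply/Lambda_eqP/asboolP; have [rx xr] := Lambda_reprP x; split=> n.
  by have [m h] := rx n; exists m; exact: mxinf_map_lesim1.
by have [m h] := xr n; exists m; exact: mxinf_map_lesim1.
Qed.

End LambdaMap.

Definition dense_rng (R : rngType) := forall x y : mxinf R,
  lesim1 x y -> exists z, lesim1 x z /\ lesim1 z y.

Definition left_normal (R : rngType) := forall a b c : mxinf R,
  a = b *i a -> b = c *i b ->
  exists d e, [/\ a = d *i a, d = e *i d & e = c *i e].

Section Cu.
Variable S : pomonType.
Implicit Types (x y : S) (z : nat -> S).

Definition increasing z := forall m n, (m <= n)%N -> z m <=p z n.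

Definition is_sup z x : Prop :=
  (forall n, z n <=p x) /\ forall y, (forall n, z n <=p y) -> x <=p y.

(* Meant for S where increasing sequences have suprema, so that s exists. *)
Definition way_below x y := forall z s,
  increasing z -> is_sup z s -> y <=p s -> exists m, x <=p z m.

Record Cu_semigroup : Prop := {
  Cu_O1 : forall z, increasing z -> exists s, is_sup z s;
  Cu_O2 : forall x, exists z, (forall n, way_below (z n) (z n.+1)) /\ is_sup z x;
  Cu_O3 : forall x' x y' y,
    way_below x' x -> way_below y' y -> way_below (x' + y') (x + y);
  Cu_O4 : forall z w s t, increasing z -> increasing w ->
    is_sup z s -> is_sup w t -> is_sup (fun n => z n + w n) (s + t)
}.

Definition weakly_increasing z := exists y : nat -> S,
  [/\ increasing y,
      forall m, exists N, forall n, (N <= n)%N -> y m <=p z n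
    & exists s, is_sup y s /\ forall n, z n <=p s].

End Cu.

Record Cu_morphism (S S' : pomonType) (f : S -> S') : Prop := {
  Cu_mor_monoid : nmod_morphism f;
  Cu_mor_le : forall x y : S, x <=p y -> f x <=p f y;
  Cu_mor_way_below : forall x y, way_below x y -> way_below (f x) (f y);
  Cu_mor_sup : forall z s, increasing z -> is_sup z s -> is_sup (f \o z) (f s)
}.

(* Objects and morphisms of SCu are pairs and maps subject to SCu_object and   *)
(* SCu_morphism, which SCu_direct_limit imposes on all the data it involves.   *)
Record SCuPair := SCuPair_of { scu_S :> pomonType; scu_W : set scu_S }.
Arguments scu_W : clear implicits.

Record SCu_object (P : SCuPair) : Prop := {
  SCu_Cu : Cu_semigroup P;
  SCu_W0 : scu_W P 0;
  SCu_WD : forall x y, scu_W P x -> scu_W P y -> scu_W P (x + y);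
  SCu_W_sup : forall z s, (forall n, scu_W P (z n)) ->
    weakly_increasing z -> is_sup z s -> scu_W P s
}.

Record SCu_morphism (P Q : SCuPair) (f : P -> Q) : Prop := {
  SCu_mor_Cu : Cu_morphism f;
  SCu_mor_W : f @` scu_W P `<=` scu_W Q
}.

Definition SCu_iso (P Q : SCuPair) (f : P -> Q) :=
  SCu_morphism f /\ exists2 g : Q -> P, SCu_morphism g & cancel f g /\ cancel g f.

Definition SCu (R : rngType) : SCuPair := @SCuPair_of (Lambda_pomon R) (@LambdaS R).

Section DirectLimits.
Context (disp : Order.disp_t) (I : preorderType disp).

Definition directed :=
  (exists i : I, True) /\ forall i j : I, exists k, (i <= k)%O /\ (j <= k)%O.

Record rngSystem := RngSystem {
  rsys :> I -> rngType;
  rsys_map : forall i j : I, (i <= j)%O -> rngHom (rsys i) (rsys j);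
  rsys_id : forall i (ii : (i <= i)%O) x, rsys_map ii x = x;
  rsys_comp : forall i j k (ij : (i <= j)%O) (jk : (j <= k)%O) (ik : (i <= k)%O) x,
    rsys_map jk (rsys_map ij x) = rsys_map ik x
}.

Definition rng_cocone (D : rngSystem) (L : rngType) (psi : forall i, rngHom (D i) L) :=
  forall i j (ij : (i <= j)%O) x, psi j (rsys_map D ij x) = psi i x.

(* A direct limit is any cocone with the universal property. *)
Definition rng_direct_limit (D : rngSystem) (L : rngType)
    (psi : forall i, rngHom (D i) L) :=
  rng_cocone psi /\
  forall (T : rngType) (f : forall i, rngHom (D i) T), rng_cocone f ->
    (exists g : rngHom L T, forall i x, g (psi i x) = f i x) /\
    (forall g g' : rngHom L T,
      (forall i x, g (psi i x) = f i x) -> (forall i x, g' (psi i x) = f i x) ->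
      g =1 g').

Record SCuSystem := SCuSystem_of {
  csys :> I -> SCuPair;
  csys_map : forall i j : I, (i <= j)%O -> csys i -> csys j
}.
Arguments csys_map D [i j] ij : rename.

Record SCu_direct_system (D : SCuSystem) : Prop := {
  csys_object : forall i, SCu_object (D i);
  csys_morphism : forall i j (ij : (i <= j)%O), SCu_morphism (csys_map D ij);
  csys_id : forall i (ii : (i <= i)%O), csys_map D ii =1 id;
  csys_comp : forall i j k (ij : (i <= j)%O) (jk : (j <= k)%O) (ik : (i <= k)%O),
    csys_map D jk \o csys_map D ij =1 csys_map D ik
}.

Record SCu_cocone (D : SCuSystem) (C : SCuPair) (f : forall i, D i -> C) : Prop := {
  SCu_cocone_object : SCu_object C;
  SCu_cocone_morphism : forall i, SCu_morphism (f i);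
  SCu_cocone_comp : forall i j (ij : (i <= j)%O), f j \o csys_map D ij =1 f i
}.

Definition SCu_direct_limit (D : SCuSystem) (C : SCuPair) (iota : forall i, D i -> C) :=
  [/\ SCu_direct_system D, SCu_cocone iota
    & forall (T : SCuPair) (f : forall i, D i -> T), SCu_cocone f ->
      (exists g : C -> T, SCu_morphism g /\ forall i, g \o iota i =1 f i) /\
      (forall g g' : C -> T, SCu_morphism g -> SCu_morphism g' ->
        (forall i, g \o iota i =1 f i) -> (forall i, g' \o iota i =1 f i) ->
        g =1 g')].

Definition SCu_system (D : rngSystem) : SCuSystem :=
  @SCuSystem_of (fun i => SCu (D i)) (fun i j ij => Lambda_map (rsys_map D ij)).

End DirectLimits.

(* Main.v *)
Require Import Defs.
From HB Require Import structures.
From mathcomp Require Import all_boot all_order ssralg.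
From mathcomp Require Import generic_quotient zify.
From mathcomp Require Import boolp classical_sets.

Set Implicit Arguments.
Unset Strict Implicit.
Unset Printing Implicit Defensive.

Import Order.TTheory GRing.Theory.

Local Open Scope quotient_scope.
Local Open Scope classical_set_scope.
Local Open Scope ring_scope.

(** Everything rests on one observation: the relation x = s y t involves finitely
    many entries, so on finite matrices it passes to direct limits.  Every matrix
    over the limit ring L comes from some D i, and psi_i a = s (psi_j b) t holds
    over L only if the images of a and b are already so related over some D k
    ([Psi_surj], [Psi_lesim1_reflect]).  Both follow from the universal property
    of L, applied to the subring of elements coming from some D i and to the ring
    of germs at infinity of families (a_i), which contains the limit.

    Over a dense ring, a sequence x_0, x_1, ... with x_n <~ x_{n+1} can be refined:
    between x_n and x_{n+1} there is room for a whole sequence z_n, and the classes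
    of the z_n are way below one another with supremum the class of x
    ([dense_interleaves], [interleaves_sup]).  Hence x << y in Lambda exactly when a
    single entry of y dominates all entries of x, and Lambda is a Cu-semigroup.
    If x is a sequence over L, the z_n can be chosen over the D i, because D i is
    dense: every element of Lambda(L) is the supremum of a way-below increasing
    sequence of elements coming from the Lambda(D i) ([Lambda_approx]).

    Given a cocone f_i : Lambda(D i) -> T, an inequality over L between elements of
    two stages yields the inequality of their images in T ([cocone_le]): pass to
    elements way below the left-hand side, where the comparison of sequences becomes
    a comparison of two matrices, and so happens at some stage.  The induced map then
    sends x to the supremum of all f_i(u) with u of stage i and image way below x;
    that it is the only Cu-morphism extending the f_i is clear from approximation.

    The submonoids S need left normality.  If x_n = y_{n+1} x_{n+1} x_n over L, put
    a = x_{n+1} x_n, b = x_{n+1} y_{n+1}, c = y_{n+2} x_{n+2}; then a = b a and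
    b = c b, equations that hold already over some D i.  There left normality, used
    over and over, interpolates between a and c a sequence d_k with
    d_k = d_{k+1} d_k, which is an element of S(D i) lying between x_n and x_{n+2}
    ([left_normal_calS], [calS_approx]).  So each element of S(L) is the supremum of
    an increasing sequence coming from the S(D i), and its image lies in W because
    W is closed under such suprema.  Thus SCu(L) is a limit in SCu, and limits are
    unique up to isomorphism. *)

(** * Suprema and the way-below relation *)

Section WayBelow.
Variable S : pomonType.
Implicit Types (x y : S) (z : nat -> S).

Lemma is_sup_unique z s t : is_sup z s -> is_sup z t -> s = t.
Proof.
by move=> [zs sP] [zt tP]; apply: pom_anti; [exact: sP|exact: tP].
Qed.

Lemma increasingS z : (forall n, z n <=p z n.+1) -> increasing z.
Proof.
move=> zS m n; elim: n => [|n IHn]; first by rewrite leqn0 => /eqP ->; exact: pom_refl.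
rewrite leq_eqVlt => /predU1P[->|/IHn h]; first exact: pom_refl.
exact: pom_trans h (zS n).
Qed.

Lemma way_below_le x' x y y' :
  x' <=p x -> way_below x y -> y <=p y' -> way_below x' y'.
Proof.
move=> x'x xy yy' z s zI zs y's.
have [m xz] := xy z s zI zs (pom_trans yy' y's).
by exists m; exact: pom_trans x'x xz.
Qed.

Lemma is_sup_const x : is_sup (fun=> x) x.
Proof. by split=> [_|y /(_ 0%N)//]; exact: pom_refl. Qed.

Lemma way_belowW x y : way_below x y -> x <=p y.
Proof.
move=> /(_ (fun=> y) y) []//; [by move=> *; exact: pom_refl| |exact: pom_refl].
exact: is_sup_const.
Qed.

Lemma increasing_weakly z s : increasing z -> is_sup z s -> weakly_increasing z.
Proof.
move=> zI zs; exists z; split=> //; last by exists s; split=> // n; exact: zs.1.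
by move=> m; exists m => n; exact: zI.
Qed.

End WayBelow.

(** * The Cu-semigroup of a dense ring *)

(** Typed in the ordered monoid, so that unification finds the order and the
    addition. *)
Definition cl (R : rngType) (x : tseq R) : Lambda_pomon R := \pi_(Lambda R) x.

Section LambdaClass.
Variable R : rngType.
Implicit Types x y : tseq R.

Lemma cl_ind (P : Lambda_pomon R -> Prop) : (forall x, P (cl x)) -> forall u, P u.
Proof. by move=> Pcl u; rewrite -[u]reprK; exact: Pcl. Qed.

Lemma cl_leP x y : cl x <=p cl y <-> lesim x y.
Proof. exact: le_pi. Qed.

Lemma cl_add x y : cl x + cl y = cl (tseq_osum x y).
Proof. exact: add_pi. Qed.

Lemma cl_seqP (u : nat -> Lambda_pomon R) : exists z, u = fun n => cl (z n).
Proof. by exists (fun n => repr (u n)); apply/funext => n; rewrite /cl reprK. Qed.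

End LambdaClass.

Section LambdaSup.
Variable R : rngType.
Implicit Types (x y s : tseq R) (z : nat -> tseq R) (a b : mxinf R).

Lemma lesim_lesim1 x y a : lesim x y -> (exists n, lesim1 a (x n)) ->
  exists n, lesim1 a (y n).
Proof.
by move=> xy [n ax]; have [m xym] := xy n; exists m; exact: lesim1_trans ax xym.
Qed.

Lemma Lambda_increasingP z :
  increasing (fun n => cl (z n)) <-> forall j k, (j <= k)%N -> lesim (z j) (z k).
Proof. by split=> zI j k /zI /cl_leP. Qed.

(** The entries of z k form a chain, so finitely many bounds among them reduce to
    one. *)
Lemma common_index z N k : (forall j, (j <= k)%N -> lesim (z j) (z k)) ->
  exists m, forall j i, (j <= k)%N -> (i <= N)%N -> lesim1 (z j i) (z k m).
Proof.
move=> zk.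
have /choice[m mP] j : exists m, (j <= k)%N -> lesim1 (z j N.+1) (z k m).
  case: (leqP j k) => [/zk/(_ N.+1)[m]|_]; last by exists 0%N.
  by exists m.
exists (\max_(j < k.+1) m j) => j i jk iN.
apply: lesim1_trans (tseq_lt (z j) (_ : i < N.+1)%N) _; first by rewrite ltnS.
apply: tseq_le (mP j jk).
by have := @leq_bigmax _ (fun j : 'I_k.+1 => m j) (inord j); rewrite inordK.
Qed.

(** Suprema are reached along a diagonal: its k-th entry is an entry of z k chosen
    so far out that it dominates the first k entries of z 0, ..., z k as well as the
    previous diagonal entry. *)
Lemma diagonal_seq z : (forall j k, (j <= k)%N -> lesim (z j) (z k)) ->
  exists s, (forall n, lesim (z n) s) /\ forall n, exists k m, lesim1 (s n) (z k m).
Proof.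
move=> zI.
have /choice[F FP] (kN : nat * nat) : exists m, forall j i, (j <= kN.1)%N ->
    (i <= kN.2)%N -> lesim1 (z j i) (z kN.1 m).
  by apply: common_index => j; exact: zI.
have [idx idxS] : exists idx : nat -> nat,
    forall k, idx k.+1 = F (k.+1, maxn (idx k) k.+1).
  by exists (fix idx k := if k is k'.+1 then F (k, maxn (idx k') k) else 0%N).
have idxP k j i : (j <= k.+1)%N -> (i <= maxn (idx k) k.+1)%N ->
  lesim1 (z j i) (z k.+1 (idx k.+1)) by rewrite idxS; exact: (FP (k.+1, _)).
have sP k : lesim1 (z k (idx k)) (z k.+1 (idx k.+1)).
  by apply: idxP; rewrite ?leq_maxl.
exists (TSeq sP); split=> [n k|n] /=; last first.
  by exists n, (idx n).+1; exact: (tseq_lesim1 (z n) (idx n)).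
exists (maxn n k).+1; apply: (idxP (maxn n k)); first by rewrite leqW ?leq_maxl.
by rewrite leq_max leqW ?orbT ?leq_maxr.
Qed.

(** In terms of representatives, a supremum is an upper bound each of whose entries
    is dominated by an entry of some member: the diagonal sequence is such a bound,
    and all suprema coincide. *)
Lemma Lambda_supP z s : (forall j k, (j <= k)%N -> lesim (z j) (z k)) ->
  is_sup (fun n => cl (z n)) (cl s) <->
  (forall n, lesim (z n) s) /\ forall n, exists k m, lesim1 (s n) (z k m).
Proof.
move=> zI; split=> [[zs sP]|[zs sz]]; last first.
  split=> [n|]; first exact/cl_leP.
  elim/cl_ind=> y zy; apply/cl_leP => n; have [k [m /lesim1_trans h]] := sz n.
  by have /cl_leP/(_ m)[l /h] := zy k; exists l.
split=> [n|n]; first exact/cl_leP.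
have [s' [zs' s'z]] := diagonal_seq zI.
have /cl_leP/(_ n)[j ss'] : cl s <=p cl s' by apply: sP => k; apply/cl_leP.
by have [k [m s'zj]] := s'z j; exists k, m; exact: lesim1_trans ss' s'zj.
Qed.

Lemma Lambda_O1 (u : nat -> Lambda_pomon R) : increasing u -> exists v, is_sup u v.
Proof.
have [z ->] := cl_seqP u => /Lambda_increasingP zI.
by have [s sP] := diagonal_seq zI; exists (cl s); apply/Lambda_supP.
Qed.

(** z n fits between two consecutive entries of x.  This is the source of all
    way-below sequences: x n.+1 separates z n from z n.+1. *)
Definition interleaves x z :=
  forall n, lesim1 (x n) (z n 0%N) /\ forall k, lesim1 (z n k) (x n.+1).

Lemma le_below_way_below x y n : (forall k, lesim1 (x k) (y n)) ->
  way_below (cl x) (cl y).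
Proof.
move=> xyn u s; have [z ->] := cl_seqP u; elim/cl_ind: s => s.
move=> /Lambda_increasingP zI /(Lambda_supP _ zI)[_ sz] /cl_leP/(_ n)[m ys].
have [k [j sz']] := sz m; exists k; apply/cl_leP => i; exists j.
exact: lesim1_trans (xyn i) (lesim1_trans ys sz').
Qed.

Lemma interleaves_way_below x z n : interleaves x z ->
  way_below (cl (z n)) (cl (z n.+1)).
Proof.
move=> xz; apply: (@le_below_way_below _ _ 0%N) => k.
by have [_ /(_ k) h] := xz n; apply: lesim1_trans h (xz n.+1).1.
Qed.

Lemma interleaves_increasing x z :
  interleaves x z -> increasing (fun n => cl (z n)).
Proof.
by move=> xz; apply: increasingS => n; apply/way_belowW/interleaves_way_below/xz.
Qed.

Lemma interleaves_sup x z : interleaves x z -> is_sup (fun n => cl (z n)) (cl x).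
Proof.
move=> xz; apply/Lambda_supP.
  by apply/Lambda_increasingP; exact: interleaves_increasing xz.
split=> n; last by exists n, 0%N; exact: (xz n).1.
by move=> k; exists n.+1; exact: (xz n).2.
Qed.

Hypothesis Rdense : dense_rng R.

(** Density is applied again and again to the pair formed by the last matrix found
    and b. *)
Lemma dense_between a b : lesim1 a b ->
  exists x, lesim1 a (x 0%N) /\ forall k, lesim1 (x k) b.
Proof.
move=> ab.
have /choice[F FP] c : exists d, lesim1 c b -> lesim1 c d /\ lesim1 d b.
  by case: (pselect (lesim1 c b)) => [/Rdense[d]|]; [exists d|exists c].
have FI k : lesim1 (iter k F a) b.
  by elim: k => // k IHk; have [] := FP _ IHk.
have FS k : lesim1 (iter k.+1 F a) (iter k.+2 F a) by have [] := FP _ (FI k.+1).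
by exists (TSeq FS); split=> [|k]; [have [] := FP _ ab|exact: FI k.+1].
Qed.

Lemma dense_interleaves x : exists z, interleaves x z.
Proof.
by have /choice[z zP] n := dense_between (tseq_lesim1 x n); exists z.
Qed.

Lemma way_belowP x y :
  way_below (cl x) (cl y) <-> exists n, forall k, lesim1 (x k) (y n).
Proof.
split=> [|[n]]; last exact: le_below_way_below.
have [z yz] := dense_interleaves y.
move=> /(_ _ _ (interleaves_increasing yz) (interleaves_sup yz) (@pom_refl _ _)).
move=> [m /cl_leP xz]; exists m.+1 => k; have [j xk] := xz k.
exact: lesim1_trans xk ((yz m).2 j).
Qed.

Lemma Lambda_Cu : Cu_semigroup (Lambda_pomon R).
Proof.
split; first exact: Lambda_O1.
- elim/cl_ind=> x; have [z xz] := dense_interleaves x.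
  exists (fun n => cl (z n)); split; last exact: interleaves_sup.
  by move=> n; exact: interleaves_way_below xz.
- elim/cl_ind=> x'; elim/cl_ind=> x; elim/cl_ind=> y'; elim/cl_ind=> y.
  move=> /way_belowP[n xn] /way_belowP[m ym].
  rewrite !cl_add.
  apply/way_belowP; exists (maxn n m) => k; apply: osum_lesim1.
    exact: tseq_le (leq_maxl _ _) (xn k).
  exact: tseq_le (leq_maxr _ _) (ym k).
- move=> u w s t; have [z ->] := cl_seqP u.
  have [v ->] := cl_seqP w; elim/cl_ind: s => s; elim/cl_ind: t => t.
  move=> /Lambda_increasingP zI /Lambda_increasingP vI.
  move=> /(Lambda_supP _ zI)[zs sz] /(Lambda_supP _ vI)[vt tv].
  rewrite cl_add.
  have -> : (fun n => cl (z n) + cl (v n)) = fun n => cl (tseq_osum (z n) (v n)).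
    by apply/funext => n; rewrite -cl_add.
  apply/Lambda_supP.
    by move=> j k jk; apply: tseq_osum_lesim; [exact: zI|exact: vI].
  split=> n; first exact: tseq_osum_lesim.
  have [k [m skm]] := sz n; have [k' [m' tkm]] := tv n.
  have [i si] : exists i, lesim1 (s n) (z (maxn k k') i).
    by apply: lesim_lesim1 (zI _ _ (leq_maxl k k')) _; exists m.
  have [j tj] : exists j, lesim1 (t n) (v (maxn k k') j).
    by apply: lesim_lesim1 (vI _ _ (leq_maxr k k')) _; exists m'.
  exists (maxn k k'), (maxn i j); apply: osum_lesim1.
    exact: tseq_le (leq_maxl _ _) si.
  exact: tseq_le (leq_maxr _ _) tj.
Qed.

End LambdaSup.

(** * Block diagonal matrices and the submonoid S *)

Section Blocks.
Variable R : rngType.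
Implicit Types x y : mxinf R.

(** diag(x, y) with x cut or padded to size m by n: rows and columns may split at
    different places. *)
Definition blocks m n x y : mxinf R :=
  bdiag (leq m) (fun b : bool => if b then m else 0%N)
        (leq n) (fun b : bool => if b then n else 0%N) (fun b => if b then y else x).

Lemma osum_blocks x y : x (+) y = blocks (corner x) (corner x) x y.
Proof. exact: osumE. Qed.

Lemma blocks_mul m p n x x' y y' :
  (forall r, (p <= r)%N -> forall i j, x i r ** y r j = 0) ->
  blocks m p x x' *i blocks p n y y' = blocks m n (x *i y) (x' *i y').
Proof.
move=> xyp; rewrite /blocks bdiag_mul.
- by congr bdiag; apply/funext => -[].
- by move=> k; case: ifP.
case=> r; first by rewrite leq_addr.
by rewrite add0n eqbF_neg negbK; exact: xyp.
Qed.

(** The outer splittings m and n are arbitrary; the inner ones may cut off only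
    entries that the products do not see. *)
Lemma blocks_mul3 m p q n x x' y y' z z' :
  (corner y <= p)%N -> (corner y <= q)%N || (corner z <= q)%N ->
  blocks m p x x' *i blocks p q y y' *i blocks q n z z' =
    blocks m n (x *i y *i z) (x' *i y' *i z').
Proof.
move=> yp yzq; rewrite -!mxinf_mulA !blocks_mul // => r le_r i j.
  rewrite (_ : (y *i z) r j = 0) ?rmul0r //= big1 // => k _.
  by rewrite cornerPl ?rmul0l // (leq_trans yp).
case/orP: yzq => /leq_trans/(_ le_r) yr; first by rewrite cornerPr ?rmul0l.
by rewrite [z _ _]cornerPl ?rmul0r.
Qed.

End Blocks.

Section LambdaS.
Variable R : rngType.

Lemma calS_LambdaS (x : tseq R) : calS x -> LambdaS (cl x).
Proof. by move=> xS; exists x. Qed.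

Lemma LambdaS0 : @LambdaS R (0 : Lambda_pomon R).
Proof.
apply: (@calS_LambdaS (tseq0 R)) => n; exists (mxinf0 R).
by apply: mxinfP => i j /=; rewrite big1 // => k _; rewrite rmul0r.
Qed.

(** The sums x n (+) x' n split at the size of x n, which varies with n, so the
    equation x n = y x n.+1 x n for the blocks gives none for the sums.  The
    rectangular blocks w n repair this: their columns split where the rows of
    w n.-1 do.  This cuts off the columns of x n beyond the size of x n.-1,
    which is harmless since x n.-1 = y x n x n.-1 involves only the others. *)
Lemma LambdaSD (u v : Lambda_pomon R) : LambdaS u -> LambdaS v -> LambdaS (u + v).
Proof.
move=> [x xS <-] [x' x'S <-]; rewrite [_ + _](cl_add x x').
have /choice[y yP] := xS; have /choice[y' y'P] := x'S.
pose c n := corner (x n).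
pose w n := blocks (c n) (c n.-1) (x n) (x' n).
have wE n : w n = blocks (c n) (c n.+1) (y n) (y' n) *i w n.+1 *i w n.
  by rewrite /w !blocks_mul3 ?leqnn ?orbT // -yP -y'P.
have wT n : lesim1 (w n) (w n.+1) by exists (blocks (c n) (c n.+1) (y n) (y' n)), (w n).
suff -> : cl (tseq_osum x x') = cl (TSeq wT).
  by apply: calS_LambdaS => n; rewrite /= {1}wE; eexists.
apply: pom_anti; apply/cl_leP => n; exists n.+1; rewrite /= osum_blocks.
  exists (blocks (c n) (c n.+1) (y n) (y' n)), (blocks (c n) (c n) (x n) (x' n)).
  by rewrite /w !blocks_mul3 ?leqnn ?orbT // -yP -y'P.
have [s [t xE]] := tseq_lesim1 x n; have [s' [t' x'E]] := tseq_lesim1 x' n.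
exists (blocks (c n) (c n.+1) s s'), (blocks (c n.+1) (c n.-1) t t').
by rewrite blocks_mul3 ?leqnn // -xE -x'E.
Qed.

(** Write X' k = a k X k.+1 b k and X k = y k X' k X k.  Then X k is a left multiple
    of X k.+1 (b k X k), so t k := b k X k satisfies t k = e t k.+1 t k for a
    suitable e, although the X k themselves need not satisfy such an equation. *)
Lemma calS_glue (X X' : nat -> mxinf R) :
  (forall k, lesim1 (X' k) (X k.+1)) ->
  (forall k, exists y, X k = y *i X' k *i X k) ->
  exists t : tseq R, [/\ calS t, forall k, lesim1 (t k) (X k.+1)
    & forall k, lesim1 (X k) (t k.+1)].
Proof.
move=> /choice[a /choice[b X'E]] /choice[y XE].
pose t k := b k *i X k; pose g k := y k *i a k *i X k.+1.
have XgE k : X k = g k *i t k by rewrite {1}XE X'E /g /t !mxinf_mulA.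
have tE k : t k = b k *i y k *i a k *i g k.+1 *i t k.+1 *i t k.
  by rewrite {1}/t {1}XgE /g {1}XgE !mxinf_mulA.
have tT k : lesim1 (t k) (t k.+1) by exists (b k *i y k *i a k *i g k.+1), (t k).
exists (TSeq tT); split=> k /=.
- by exists (b k *i y k *i a k *i g k.+1).
- by exists (b k *i y k *i a k), (t k); rewrite {1}/t {1}XgE /g !mxinf_mulA.
- by exists (y k *i a k *i g k.+1), (t k); rewrite {1}XgE /g {1}XgE !mxinf_mulA.
Qed.

(** All but finitely many z n dominate a given entry of the supremum s, and all
    entries of the z n are dominated by entries of s.  So one can walk through the
    representatives of the z n along a sequence of entries cofinal in s in which the
    successor, inside its own z n, of each entry is still dominated by the next one;
    calS_glue turns this walk into an element of S. *)
Lemma LambdaS_sup (z : nat -> Lambda_pomon R) s :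
  (forall n, LambdaS (z n)) -> weakly_increasing z -> is_sup z s -> LambdaS s.
Proof.
move=> zS [v [vI vz [s' [vs' zs']]]] zs.
have {s' vs' zs'} vs : is_sup v s.
  rewrite (_ : s = s') //; apply: pom_anti; first exact: zs.2.
  apply: vs'.2 => m; have [N /(_ N (leqnn N)) vN] := vz m.
  exact: pom_trans vN (zs.1 N).
have {zS}/choice[Z ZP] n : exists x, calS x /\ z n = cl x.
  by have [x xS <-] := zS n; exists x.
have [V vE] := cl_seqP v; elim/cl_ind: s zs vs => S zs.
rewrite {}vE in vI vz *.
move=> /(Lambda_supP _ ((Lambda_increasingP _).1 vI))[_ SV].
have ZS n : lesim (Z n) S by apply/cl_leP; rewrite -(ZP n).2; exact: zs.1.
have eventually k : exists N, forall n, (N <= n)%N -> exists i, lesim1 (S k) (Z n i).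
  have [m [j Sk]] := SV k; have [N VN] := vz m; exists N => n /VN.
  rewrite (ZP n).2 => /cl_leP/(_ j)[i VZ]; exists i; exact: lesim1_trans Sk VZ.
(* p and q are positions (index of the sequence, index of the entry) of the walk *)
have step k (p : nat * nat) : exists q : nat * nat,
    lesim1 (Z p.1 p.2.+1) (Z q.1 q.2) /\ lesim1 (S k) (Z q.1 q.2).
  have [l Zl] := ZS p.1 p.2.+1.
  have [N SN] := eventually l; have [N' SN'] := eventually k.
  have [i Si] := SN _ (leq_maxl N N'); have [j Sj] := SN' _ (leq_maxr N N').
  exists (maxn N N', maxn i j); split.
    exact: tseq_le (leq_maxl _ _) (lesim1_trans Zl Si).
  exact: tseq_le (leq_maxr _ _) Sj.
have /choice[F FP] kp := step kp.1 kp.2.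
have [q qE] : exists q : nat -> nat * nat,
    forall k, exists p, q k = F (k, p) /\ q k.+1 = F (k.+1, q k).
  exists (fix q k := F (k, if k is k'.+1 then q k' else (0, 0)%N)).
  by case=> [|k]; eexists; split.
pose X k := Z (q k).1 (q k).2; pose X' k := Z (q k).1 (q k).2.+1.
have X'X k : lesim1 (X' k) (X k.+1).
  by have [_ [_ qS]] := qE k; rewrite /X qS; exact: (FP (k.+1, q k)).1.
have SX k : lesim1 (S k) (X k).
  by have [p [qk _]] := qE k; rewrite /X qk; exact: (FP (k, p)).2.
have [t [tS tX Xt]] := calS_glue X'X (fun k => (ZP (q k).1).1 (q k).2).
suff -> : cl S = cl t by exact: calS_LambdaS.
apply: pom_anti; apply/cl_leP => k.
  by exists k.+1; exact: lesim1_trans (SX k) (Xt k).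
by apply: lesim_lesim1 (ZS (q k.+1).1) _; exists (q k.+1).2; exact: tX.
Qed.

End LambdaS.

(** * Induced morphisms *)

Section LambdaMap.
Variables (R R' : rngType) (phi : rngHom R R').

Lemma cl_map x : Lambda_map phi (cl x) = cl (tseq_map phi x).
Proof. exact: Lambda_mapE. Qed.

Lemma cl_map_eq (x : tseq R) (y : tseq R') : (forall n, mxinf_map phi (x n) = y n) ->
  Lambda_map phi (cl x) = cl y.
Proof.
move=> xy; rewrite cl_map; apply: (@pom_anti (Lambda_pomon R')); apply/cl_leP => n;
  exists n.+1 => /=; [rewrite xy; exact: tseq_lesim1|rewrite -xy].
exact/mxinf_map_lesim1/tseq_lesim1.
Qed.

Lemma Lambda_map_le (u v : Lambda_pomon R) : u <=p v ->
  (Lambda_map phi u : Lambda_pomon R') <=p Lambda_map phi v.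
Proof.
elim/cl_ind: u => x; elim/cl_ind: v => y /cl_leP xy; rewrite !cl_map.
by apply/cl_leP => n; have [m xym] := xy n; exists m; exact: mxinf_map_lesim1.
Qed.

Lemma corner_map (x : mxinf R) : (corner (mxinf_map phi x) <= corner x)%N.
Proof. by apply: corner_min => i j /cornerP /= ->; rewrite raddf0. Qed.

Lemma map_blocks m n (x y : mxinf R) :
  mxinf_map phi (blocks m n x y) = blocks m n (mxinf_map phi x) (mxinf_map phi y).
Proof.
apply: mxinfP => i j /=; case: ifP => _; last by rewrite raddf0.
by case: (_ <= _)%N.
Qed.

(** phi may shrink the corner of x, so phi (x (+) y) and phi x (+) phi y can differ
    as matrices; these two lemmas compare them up to one
    step of lesim1. *)
Lemma mxinf_map_osum_lesim1 (x x' y y' : mxinf R) : lesim1 x x' -> lesim1 y y' ->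
  lesim1 (mxinf_map phi (x (+) y)) (mxinf_map phi x' (+) mxinf_map phi y').
Proof.
move=> [s [t xE]] [s' [t' yE]].
rewrite !osum_blocks map_blocks.
set c := corner x; set c' := corner (mxinf_map phi x').
exists (blocks c c' (mxinf_map phi s) (mxinf_map phi s')).
exists (blocks c' c (mxinf_map phi t) (mxinf_map phi t')).
by rewrite blocks_mul3 ?leqnn // -!mxinf_mapM -xE -yE.
Qed.

Lemma mxinf_map_osum_lesim1' (x x' y y' : mxinf R) : lesim1 x x' -> lesim1 y y' ->
  lesim1 (mxinf_map phi x (+) mxinf_map phi y) (mxinf_map phi (x' (+) y')).
Proof.
move=> [s [t xE]] [s' [t' yE]].
rewrite !osum_blocks map_blocks.
set c := corner _; set c' := corner x'.
exists (blocks c c' (mxinf_map phi s) (mxinf_map phi s')).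
exists (blocks c' c (mxinf_map phi t) (mxinf_map phi t')).
by rewrite blocks_mul3 ?corner_map ?leqnn // -!mxinf_mapM -xE -yE.
Qed.

Lemma Lambda_mapD (u v : Lambda_pomon R) :
  Lambda_map phi (u + v) = (Lambda_map phi u : Lambda_pomon R') + Lambda_map phi v.
Proof.
elim/cl_ind: u => x; elim/cl_ind: v => y; rewrite cl_add !cl_map cl_add.
apply: (@pom_anti (Lambda_pomon R')); apply/cl_leP => n; exists n.+1.
  by apply: mxinf_map_osum_lesim1; exact: tseq_lesim1.
by apply: mxinf_map_osum_lesim1'; exact: tseq_lesim1.
Qed.

Lemma Lambda_map0 : Lambda_map phi (0 : Lambda_pomon R) = 0 :> Lambda_pomon R'.
Proof.
rewrite [LHS](cl_map (tseq0 R)); apply: (@pom_anti (Lambda_pomon R'));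
  last exact: pom_ge0.
apply/(@cl_leP _ _ (tseq0 R')) => n; exists 0%N; exists (mxinf0 R'), (mxinf0 R').
by apply: mxinfP => i j /=; rewrite raddf0 big1 // => k _; rewrite rmul0r.
Qed.

Lemma Lambda_map_sup (z : nat -> Lambda_pomon R) s : increasing z -> is_sup z s ->
  is_sup (fun n => Lambda_map phi (z n) : Lambda_pomon R') (Lambda_map phi s).
Proof.
have [Z ->] := cl_seqP z; elim/cl_ind: s => S.
move=> /Lambda_increasingP ZI /(Lambda_supP _ ZI)[ZS SZ].
have -> : (fun n => Lambda_map phi (cl (Z n)) : Lambda_pomon R') =
    fun n => cl (tseq_map phi (Z n)) by apply/funext => n; exact: cl_map.
have map_le x y : lesim x y -> lesim (tseq_map phi x) (tseq_map phi y).
  by move/cl_leP/Lambda_map_le; rewrite !cl_map => /cl_leP.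
rewrite cl_map; apply/Lambda_supP; first by move=> j k /ZI; exact: map_le.
split=> n; first exact: map_le.
by have [k [m SZn]] := SZ n; exists k, m; exact: mxinf_map_lesim1.
Qed.

Lemma Lambda_mapS (u : Lambda_pomon R) : LambdaS u -> LambdaS (Lambda_map phi u).
Proof.
move=> [x xS <-]; rewrite [Lambda_map _ _]cl_map; apply: calS_LambdaS => n.
by have [y xE] := xS n; exists (mxinf_map phi y); rewrite /= {1}xE !mxinf_mapM.
Qed.

Lemma Lambda_map_SCu : dense_rng R ->
  SCu_morphism (P := SCu R) (Q := SCu R') (Lambda_map phi).
Proof.
move=> Rdense; split; last by move=> _ [u uS <-]; exact: Lambda_mapS.
split.
- by split; [exact: Lambda_map0|exact: Lambda_mapD].
- exact: Lambda_map_le.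
- elim/cl_ind=> x; elim/cl_ind=> y /(way_belowP Rdense)[n xn]; rewrite !cl_map.
  by apply: (@le_below_way_below _ _ _ n) => k; exact: mxinf_map_lesim1.
- exact: Lambda_map_sup.
Qed.

End LambdaMap.

Lemma SCu_SCu_object (R : rngType) : dense_rng R -> SCu_object (SCu R).
Proof.
move=> Rdense; split; first exact: Lambda_Cu.
- exact: LambdaS0.
- exact: LambdaSD.
- exact: LambdaS_sup.
Qed.

(** * Direct limits of rings *)

Definition mk_rngHom (R R' : rngType) (f : R -> R') (fB : zmod_morphism f)
    (fM : {morph f : x y / x ** y}) : rngHom R R' :=
  @RngHom R R' (HB.pack f (GRing.isZmodMorphism.Build R R' f fB)) fM.

Definition rmul_closed (R : rngType) (P : {pred R}) :=
  forall x y, x \in P -> y \in P -> x ** y \in P.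

(** The closure proof is a parameter of the type so that the ring structure can be
    inferred from it. *)
Record subrng (R : rngType) (P : zmodClosed R) (PM : rmul_closed P) :=
  Subrng { subrng_val : R; subrng_valP : subrng_val \in P }.

Section Subrng.
Variables (R : rngType) (P : zmodClosed R) (PM : rmul_closed P).

HB.instance Definition _ := [isSub for @subrng_val R P PM].
HB.instance Definition _ := [Choice of subrng PM by <:].
HB.instance Definition _ := [SubChoice_isSubZmodule of subrng PM by <:].

Definition subrng_mul (x y : subrng PM) : subrng PM :=
  Subrng PM (PM (subrng_valP x) (subrng_valP y)).

Lemma subrng_mulA : associative subrng_mul.
Proof. by move=> x y z; apply: val_inj; rewrite /= rmulA. Qed.

Lemma subrng_mulDl : left_distributive subrng_mul +%R.
Proof. by move=> x y z; apply: val_inj; rewrite /= rmulDl. Qed.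

Lemma subrng_mulDr : right_distributive subrng_mul +%R.
Proof. by move=> x y z; apply: val_inj; rewrite /= rmulDr. Qed.

HB.instance Definition _ := Zmodule_isRng.Build (subrng PM)
  subrng_mulA subrng_mulDl subrng_mulDr.

End Subrng.

Section Germs.
Context (disp : Order.disp_t) (I : preorderType disp) (D : rngSystem I).
Hypothesis Idirected : directed I.

Definition family := forall i, D i.
HB.instance Definition _ := gen_eqMixin family.
HB.instance Definition _ := gen_choiceMixin family.
Implicit Types x y z : family.

Definition eventually (P : I -> Prop) := exists i, forall j, (i <= j)%O -> P j.

Lemma eventually_and P Q : eventually P -> eventually Q ->
  eventually (fun i => P i /\ Q i).
Proof.
move=> [i Pi] [j Qj]; have [_ /(_ i j)[k [ik jk]]] := Idirected.
by exists k => l kl; split; [apply: Pi; exact: le_trans kl|apply: Qj; exact: le_trans kl].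
Qed.

Definition eventually_eq x y : bool := `[< eventually (fun i => x i = y i) >].

Lemma eventually_eq_refl : reflexive eventually_eq.
Proof. by move=> x; apply/asboolP; have [[i _] _] := Idirected; exists i. Qed.

Lemma eventually_eq_sym : symmetric eventually_eq.
Proof. by move=> x y; apply/asboolP/asboolP => -[i xy]; exists i => j /xy. Qed.

Lemma eventually_eq_trans : transitive eventually_eq.
Proof.
move=> y x z /asboolP xy /asboolP yz; apply/asboolP.
by have [i xyz] := eventually_and xy yz; exists i => j /xyz[-> ->].
Qed.

Definition eventually_equiv :=
  EquivRel eventually_eq eventually_eq_refl eventually_eq_sym eventually_eq_trans.

(** The direct limit embeds in this ring: germs along the directed order of
    arbitrary families, with no compatibility between the members.  Operations are
    thus computed on representatives without choosing common indices. *)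
Definition germs := {eq_quot eventually_equiv}.
HB.instance Definition _ := Choice.on germs.
HB.instance Definition _ := EqQuotient.on germs.

Definition germ x : germs := \pi_germs x.

Lemma germP x y : germ x = germ y <-> eventually (fun i => x i = y i).
Proof.
split=> [/(@eqmodP _ eventually_equiv)/asboolP//|xy].
exact/(@eqmodP _ eventually_equiv)/asboolP.
Qed.

Lemma germ_ind (P : germs -> Prop) : (forall x, P (germ x)) -> forall g, P g.
Proof. by move=> Pg g; rewrite -[g]reprK; exact: Pg. Qed.

Definition germ_op1 (op : forall i, D i -> D i) (g : germs) : germs :=
  germ (fun i => op i (repr g i)).

Definition germ_op2 (op : forall i, D i -> D i -> D i) (g h : germs) : germs :=
  germ (fun i => op i (repr g i) (repr h i)).

Lemma germ_repr x : eventually (fun i => repr (germ x) i = x i).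
Proof. by apply/germP; rewrite /germ reprK. Qed.

Lemma germ_op1E op x : germ_op1 op (germ x) = germ (fun i => op i (x i)).
Proof. by apply/germP; have [i xi] := germ_repr x; exists i => j /xi ->. Qed.

Lemma germ_op2E op x y :
  germ_op2 op (germ x) (germ y) = germ (fun i => op i (x i) (y i)).
Proof.
apply/germP; have [i xyi] := eventually_and (germ_repr x) (germ_repr y).
by exists i => j /xyi[-> ->].
Qed.

Definition germ_zero : germs := germ (fun i => 0).
Definition germ_opp := germ_op1 (fun i => -%R).
Definition germ_add := germ_op2 (fun i => +%R).
Definition germ_mul := germ_op2 (fun i => @rmul (D i)).

Ltac germ_ext := repeat elim/germ_ind => ?;
  rewrite /germ_add /germ_opp /germ_mul /germ_zero !(germ_op1E, germ_op2E);
  congr germ; apply: functional_extensionality_dep => i.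

Lemma germ_addA : associative germ_add.
Proof. by germ_ext; rewrite addrA. Qed.

Lemma germ_addC : commutative germ_add.
Proof. by germ_ext; rewrite addrC. Qed.

Lemma germ_add0 : left_id germ_zero germ_add.
Proof. by germ_ext; rewrite add0r. Qed.

Lemma germ_addN : left_inverse germ_zero germ_opp germ_add.
Proof. by germ_ext; rewrite addNr. Qed.

HB.instance Definition _ :=
  GRing.isZmodule.Build germs germ_addA germ_addC germ_add0 germ_addN.

Lemma germ_mulA : associative germ_mul.
Proof. by germ_ext; rewrite rmulA. Qed.

Lemma germ_mulDl : left_distributive germ_mul germ_add.
Proof. by germ_ext; rewrite rmulDl. Qed.

Lemma germ_mulDr : right_distributive germ_mul germ_add.
Proof. by germ_ext; rewrite rmulDr. Qed.

HB.instance Definition _ :=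
  Zmodule_isRng.Build germs germ_mulA germ_mulDl germ_mulDr.

(** The value 0 at the indices not above i is arbitrary. *)
Definition section_at i (a : D i) : family := fun j =>
  if pselect (i <= j)%O is left ij then rsys_map D ij a else 0.

Lemma section_atE i (a : D i) j (ij : (i <= j)%O) : section_at a j = rsys_map D ij a.
Proof.
rewrite /section_at; case: pselect => // ij'.
by rewrite (bool_irrelevance ij ij').
Qed.

Lemma germ_section_additive i : zmod_morphism (fun a : D i => germ (section_at a)).
Proof.
move=> a b; rewrite [RHS]/(germ_add _ (germ_opp _)) /germ_opp germ_op1E.
rewrite /germ_add germ_op2E; apply/germP.
by exists i => j ij; rewrite !(section_atE _ ij) raddfB.
Qed.

Lemma germ_section_mul i : {morph (fun a : D i => germ (section_at a)) : a b / a ** b}.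
Proof.
move=> a b; rewrite [RHS]germ_op2E; apply/germP.
by exists i => j ij; rewrite !(section_atE _ ij) rng_funM.
Qed.

Definition germ_at i : rngHom (D i) germs :=
  mk_rngHom (@germ_section_additive i) (@germ_section_mul i).

Lemma germ_at_cocone : rng_cocone germ_at.
Proof.
move=> i j ij a; apply/germP; exists j => k jk.
rewrite (section_atE _ jk) (section_atE _ (le_trans ij jk)).
exact: rsys_comp.
Qed.

Variables (L : rngType) (psi : forall i, rngHom (D i) L).
Hypothesis psiL : rng_direct_limit psi.

(** L maps to the germs compatibly with the D i, and two elements with the same germ
    agree at some later index. *)
Lemma rng_limit_inj i (a b : D i) : psi i a = psi i b ->
  exists j (ij : (i <= j)%O), rsys_map D ij a = rsys_map D ij b.
Proof.
move=> ab; have [_ /(_ germs germ_at germ_at_cocone)[[g gE] _]] := psiL.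
have /germP[j abj] : germ_at i a = germ_at i b by rewrite -!gE ab.
have [_ /(_ i j)[k [ik jk]]] := Idirected; exists k, ik.
by have := abj k jk; rewrite !(section_atE _ ik).
Qed.

Definition limit_image : {pred L} := fun x : L => `[< exists i a, psi i a = x >].

Lemma limit_imageP (x : L) : reflect (exists i a, psi i a = x) (x \in limit_image).
Proof. exact: asboolP. Qed.

Lemma limit_image2 (x y : L) : x \in limit_image -> y \in limit_image ->
  exists i a b, psi i a = x /\ psi i b = y.
Proof.
move=> /limit_imageP[i [a <-]] /limit_imageP[j [b <-]].
have [_ /(_ i j)[k [ik jk]]] := Idirected.
by exists k, (rsys_map D ik a), (rsys_map D jk b); rewrite !psiL.1.
Qed.

Lemma limit_image_zmod : zmod_closed limit_image.
Proof.
split=> [|x y xI yI].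
  by apply/limit_imageP; have [[i _] _] := Idirected; exists i, 0; rewrite raddf0.
have [i [a [b [<- <-]]]] := limit_image2 xI yI.
by apply/limit_imageP; exists i, (a - b); rewrite raddfB.
Qed.

Definition limit_image_zmodClosed : zmodClosed L :=
  HB.pack limit_image (GRing.isZmodClosed.Build L limit_image limit_image_zmod).

Lemma limit_image_mul : rmul_closed limit_image_zmodClosed.
Proof.
move=> x y xI yI; have [i [a [b [<- <-]]]] := limit_image2 xI yI.
by apply/limit_imageP; exists i, (a ** b); rewrite rng_funM.
Qed.

(** The image is a subring through which all psi i factor, so L maps to it; by
    uniqueness L -> image -> L is the identity. *)
Lemma rng_limit_surj (x : L) : exists i a, psi i a = x.
Proof.
have inI i (a : D i) : psi i a \in limit_image by apply/limit_imageP; exists i, a.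
pose f i (a : D i) : subrng limit_image_mul := Subrng limit_image_mul (inI i a).
have fB i : zmod_morphism (f i) by move=> a b; apply: val_inj; rewrite /= raddfB.
have fM i : {morph f i : a b / a ** b}.
  by move=> a b; apply: val_inj; rewrite /= rng_funM.
have fC : rng_cocone (fun i => mk_rngHom (fB i) (fM i)).
  by move=> i j ij a; apply: val_inj; rewrite /= psiL.1.
have [[g gE] _] := psiL.2 _ _ fC.
have hB : zmod_morphism (fun a : L => subrng_val (g a)) by move=> a b; rewrite raddfB.
have hM : {morph (fun a : L => subrng_val (g a)) : a b / a ** b}.
  by move=> a b; rewrite rng_funM.
have idB : zmod_morphism (@id L) by [].
have [_ uniq] := psiL.2 _ _ psiL.1.
have /= <- : mk_rngHom hB hM x = mk_rngHom idB (fun _ _ => erefl) x.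
  by apply: uniq => //= i a; rewrite gE.
exact/limit_imageP/subrng_valP.
Qed.

End Germs.

(** * Matrices over a direct limit *)

Section LimitMatrices.
Context (disp : Order.disp_t) (I : preorderType disp) (D : rngSystem I).
Variables (L : rngType) (psi : forall i, rngHom (D i) L).
Hypothesis Idirected : directed I.
Hypothesis psiL : rng_direct_limit psi.

Local Notation Psi i := (mxinf_map (psi i)).
Local Notation Phi ij := (mxinf_map (rsys_map D ij)).

Lemma directed_bound (T : finType) (f : T -> I) : exists k, forall t, (f t <= k)%O.
Proof.
suff [k kP] : exists k, forall t, t \in enum T -> (f t <= k)%O.
  by exists k => t; apply: kP; rewrite mem_enum.
elim: (enum T) => [|t s [k kP]]; first by have [[k _] _] := Idirected; exists k.
have [_ /(_ (f t) k)[l [tl kl]]] := Idirected; exists l => u.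
by rewrite inE => /predU1P[->//|/kP/le_trans]; apply.
Qed.

Lemma Psi_comp i j (ij : (i <= j)%O) a : Psi j (Phi ij a) = Psi i a.
Proof. by apply: mxinfP => k l /=; rewrite psiL.1. Qed.

Lemma Phi_comp i j k (ij : (i <= j)%O) (jk : (j <= k)%O) (ik : (i <= k)%O) a :
  Phi jk (Phi ij a) = Phi ik a.
Proof. by apply: mxinfP => m l /=; rewrite (rsys_comp _ _ ik). Qed.

Lemma Psi_surj x : exists i a, Psi i a = x.
Proof.
have /choice[p pP] (kl : nat * nat) : exists p : {i & D i},
    psi (tag p) (tagged p) = x kl.1 kl.2.
  have [i [a aP]] := rng_limit_surj Idirected psiL (x kl.1 kl.2).
  by exists (Tagged (fun i => D i) a).
pose n := corner x.
have [k kP] := directed_bound (fun kl : 'I_n * 'I_n => tag (p (val kl.1, val kl.2))).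
have /choice[a aP] (ml : nat * nat) : exists a : D k, psi k a = x ml.1 ml.2 /\
    ((n <= ml.1)%N || (n <= ml.2)%N -> a = 0).
  case: ml => m l; case: (boolP ((n <= m)%N || (n <= l)%N)) => [nml|].
    by exists 0; rewrite raddf0 /= cornerP.
  rewrite negb_or -!ltnNge => /andP[mn ln].
  exists (rsys_map D (kP (Ordinal mn, Ordinal ln)) (tagged (p (m, l)))).
  by rewrite psiL.1 pP.
have aF : exists n, forall m l, (n <= m)%N || (n <= l)%N -> a (m, l) = 0.
  by exists n => m l; exact: (aP (m, l)).2.
exists k, (mxinf_of (f := fun m l => a (m, l)) aF); apply: mxinfP => m l.
exact: (aP (m, l)).1.
Qed.

Lemma Psi_inj i a b : Psi i a = Psi i b ->
  exists j (ij : (i <= j)%O), Phi ij a = Phi ij b.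
Proof.
move=> ab; pose n := maxn (corner a) (corner b).
have /choice[j jP] (kl : 'I_n * 'I_n) : exists j, exists ij : (i <= j)%O,
    rsys_map D ij (a kl.1 kl.2) = rsys_map D ij (b kl.1 kl.2).
  apply: (rng_limit_inj Idirected psiL).
  by have /(congr1 (fun x => mxinf_fun x kl.1 kl.2)) := ab.
have [m mP] := directed_bound j; have [_ /(_ i m)[q [iq mq]]] := Idirected.
exists q, iq; apply: mxinfP => k l /=.
case: (ltnP k n) => [kn|]; last first.
  by rewrite geq_max => /andP[ka kb]; rewrite !cornerPl.
case: (ltnP l n) => [ln|]; last first.
  by rewrite geq_max => /andP[la lb]; rewrite !cornerPr.
have [ij ijE] := jP (Ordinal kn, Ordinal ln).
have jq := le_trans (mP (Ordinal kn, Ordinal ln)) mq.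
by rewrite -!(rsys_comp ij jq iq) ijE.
Qed.

Lemma Psi_surj_fin (T : finType) (X : T -> mxinf L) :
  exists i A, forall t : T, Psi i (A t) = X t.
Proof.
have /choice[p pP] t : exists p : {i & mxinf (D i)}, Psi (tag p) (tagged p) = X t.
  by have [i [a aP]] := Psi_surj (X t); exists (Tagged (fun i => mxinf (D i)) a).
have [k kP] := directed_bound (fun t => tag (p t)).
by exists k, (fun t => Phi (kP t) (tagged (p t))) => t; rewrite Psi_comp.
Qed.

Lemma Psi_lesim1_reflect i j a b : lesim1 (Psi i a) (Psi j b) ->
  exists k (ik : (i <= k)%O) (jk : (j <= k)%O), lesim1 (Phi ik a) (Phi jk b).
Proof.
move=> [s [t abE]].
have [l [st stE]] := Psi_surj_fin (fun c : bool => if c then s else t).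
have [m mP] := directed_bound (fun c : option bool =>
  if c is Some c then if c then i else j else l).
have im := mP (Some true); have jm := mP (Some false); have lm := mP None.
have [] := @Psi_inj m (Phi im a) (Phi lm (st true) *i Phi jm b *i Phi lm (st false)).
  by rewrite !mxinf_mapM !Psi_comp !stE.
move=> k [mk]; rewrite !mxinf_mapM (Phi_comp im mk (le_trans im mk)).
rewrite (Phi_comp jm mk (le_trans jm mk)) => kE.
by exists k, (le_trans im mk), (le_trans jm mk); eexists; eexists; exact: kE.
Qed.

Lemma lesim1_lift x y : lesim1 x y ->
  exists i a b, [/\ Psi i a = x, Psi i b = y & lesim1 a b].
Proof.
have [i [a <-]] := Psi_surj x; have [j [b <-]] := Psi_surj y.
move=> /Psi_lesim1_reflect[k [ik [jk ab]]].
by exists k, (Phi ik a), (Phi jk b); rewrite !Psi_comp.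
Qed.

Lemma unit_chain_lift a b c : a = b *i a -> b = c *i b -> exists i a' b' c',
  [/\ Psi i a' = a, Psi i b' = b & Psi i c' = c] /\ a' = b' *i a' /\ b' = c' *i b'.
Proof.
move=> ab bc.
have [i [s sE]] := Psi_surj_fin (fun t : option bool =>
  if t is Some t then if t then a else b else c).
have aE := sE (Some true); have bE := sE (Some false); have cE := sE None.
move: (s (Some true)) (s (Some false)) (s None) aE bE cE => a1 b1 c1 /= aE bE cE {s sE}.
have [] := @Psi_inj i a1 (b1 *i a1); first by rewrite mxinf_mapM aE bE.
move=> j [ij abj].
have [] := @Psi_inj j (Phi ij b1) (Phi ij c1 *i Phi ij b1).
  by rewrite mxinf_mapM !Psi_comp bE cE.
move=> k [jk]; rewrite mxinf_mapM => bck.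
exists k, (Phi jk (Phi ij a1)), (Phi jk (Phi ij b1)), (Phi jk (Phi ij c1)).
by rewrite !Psi_comp; split=> //; split=> //; rewrite -!mxinf_mapM -abj.
Qed.

Hypothesis Ddense : forall i, dense_rng (D i).

Lemma limit_dense : dense_rng L.
Proof.
move=> x y /lesim1_lift[i [a [b [<- <- /Ddense[c [ac cb]]]]]].
by exists (Psi i c); split; exact: mxinf_map_lesim1.
Qed.

(** The relation x n <~ x n.+1 holds already at some stage, where density supplies
    the sequence in between. *)
Lemma limit_approx (x : tseq L) : exists p : nat -> {i & tseq (D i)},
  interleaves x (fun n => tseq_map (psi (tag (p n))) (tagged (p n))).
Proof.
suff /choice[p pP] n : exists p : {i & tseq (D i)},
    lesim1 (x n) (Psi (tag p) (tagged p 0%N)) /\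
    forall k, lesim1 (Psi (tag p) (tagged p k)) (x n.+1).
  by exists p.
have [i [a [b [<- <- ab]]]] := lesim1_lift (tseq_lesim1 x n).
have [z [az zb]] := dense_between (@Ddense i) ab.
exists (Tagged (fun i => tseq (D i)) z) => /=.
by split=> [|k]; exact: mxinf_map_lesim1.
Qed.

End LimitMatrices.

(** Left normality applied to (a, b, c) gives (d, e), and (d, e, c) satisfies the
    same hypotheses again; d k is the element obtained at step k.+1. *)
Lemma left_normal_calS (R : rngType) (a b c : mxinf R) :
  left_normal R -> a = b *i a -> b = c *i b ->
  exists d : tseq R, [/\ calS d, a = d 0%N *i a & forall k, d k = c *i d k].
Proof.
move=> Rnormal ab bc.
have /choice[F FP] (p : mxinf R * mxinf R) : exists q : mxinf R * mxinf R,
    p.1 = p.2 *i p.1 -> p.2 = c *i p.2 ->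
    [/\ p.1 = q.1 *i p.1, q.1 = q.2 *i q.1 & q.2 = c *i q.2].
  have [[h1 h2]|h] := pselect (p.1 = p.2 *i p.1 /\ p.2 = c *i p.2).
    by have [d [e dP]] := Rnormal _ _ _ h1 h2; exists (d, e).
  by exists p => h1 h2; case: h.
pose p k := iter k F (a, b).
have pP k : (p k).1 = (p k).2 *i (p k).1 /\ (p k).2 = c *i (p k).2.
  elim: k => [|k [h1 h2]]; first by split.
  by have [_ e1 e2] := FP _ h1 h2; split; [exact: e1|exact: e2].
have pS k : (p k).1 = (p k.+1).1 *i (p k).1.
  by have [h1 h2] := pP k; have [e _ _] := FP _ h1 h2; exact: e.
have dS k : (p k.+1).1 = (p k.+2).2 *i (p k.+2).1 *i (p k.+1).1.
  by rewrite -(pP k.+2).1 -pS.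
have dT k : lesim1 (p k.+1).1 (p k.+2).1 by exists (p k.+2).2, (p k.+1).1.
exists (TSeq dT); split=> [k||k] /=.
- by exists (p k.+2).2; exact: dS.
- exact: pS 0%N.
- by have [pE pc] := pP k.+1; rewrite [LHS]pE {1}pc [in RHS]pE mxinf_mulA.
Qed.

(** * The universal property *)

Section UniversalProperty.
Context (disp : Order.disp_t) (I : preorderType disp) (D : rngSystem I).
Variables (L : rngType) (psi : forall i, rngHom (D i) L).
Hypothesis Idirected : directed I.
Hypothesis psiL : rng_direct_limit psi.
Hypothesis Ddense : forall i, dense_rng (D i).

Local Notation LL := (Lambda_pomon L).

Lemma Lambda_map_comp i j (ij : (i <= j)%O) (u : Lambda_pomon (D i)) :
  Lambda_map (psi j) (Lambda_map (rsys_map D ij) u) = Lambda_map (psi i) u.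
Proof.
elim/cl_ind: u => x; rewrite [RHS]cl_map [X in Lambda_map _ X]cl_map.
by apply: cl_map_eq => n; rewrite /= (Psi_comp psiL).
Qed.

Definition stage := {i & Lambda_pomon (D i)}.
Definition at_stage i (u : Lambda_pomon (D i)) : stage :=
  Tagged (fun i => Lambda_pomon (D i)) u.
Definition in_limit (p : stage) : LL := Lambda_map (psi (tag p)) (tagged p).

Lemma Lambda_approx (x : LL) : exists p : nat -> stage,
  (forall n, way_below (in_limit (p n)) (in_limit (p n.+1))) /\
  is_sup (fun n => in_limit (p n)) x.
Proof.
elim/cl_ind: x => x; have [p xp] := limit_approx Idirected psiL Ddense x.
exists (fun n => at_stage (cl (tagged (p n)))).
have inE n : in_limit (at_stage (cl (tagged (p n)))) =
    cl (tseq_map (psi (tag (p n))) (tagged (p n))) by exact: cl_map.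
split=> [n|]; first by rewrite !inE; exact: interleaves_way_below xp.
have -> : (fun n => in_limit (at_stage (cl (tagged (p n))))) =
  fun n => cl (tseq_map (psi (tag (p n))) (tagged (p n))) by apply/funext.
exact: interleaves_sup xp.
Qed.

Section Cocone.
Variables (T : SCuPair) (f : forall i, SCu_system D i -> T).
Hypothesis fT : SCu_cocone f.

Definition in_target (p : stage) : T := @f (tag p) (tagged p).

Let fmor i := SCu_mor_Cu (SCu_cocone_morphism fT i).

Lemma cocone_step i k (ik : (i <= k)%O) (u : Lambda_pomon (D i)) :
  @f i u = @f k (Lambda_map (rsys_map D ik) u).
Proof. exact: esym (SCu_cocone_comp fT ik u). Qed.

(** It suffices to bound f i on the classes z n interleaved with x.  All entries of
    z n lie below x n.+1, so that only the relation between x n.+1 and one entry of y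
    matters, and this one descends to a stage. *)
Lemma cocone_le p q : in_limit p <=p in_limit q -> in_target p <=p in_target q.
Proof.
case: p q => [i u] [j v]; rewrite /in_limit /in_target /=.
elim/cl_ind: u => x; elim/cl_ind: v => y.
move=> xy; have {xy}/cl_leP xy : cl (tseq_map (psi i) x) <=p cl (tseq_map (psi j) y).
  by rewrite -!cl_map.
have [z xz] := dense_interleaves (@Ddense i) x.
have [_] := Cu_mor_sup (fmor i) (interleaves_increasing xz) (interleaves_sup xz).
apply=> n /=; have [m /(Psi_lesim1_reflect Idirected psiL)[k [ik [jk h]]]] := xy n.+1.
rewrite (cocone_step ik) (cocone_step jk).
apply: (Cu_mor_le (fmor k)).
suff : cl (tseq_map (rsys_map D ik) (z n)) <=p cl (tseq_map (rsys_map D jk) y).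
  by rewrite -!cl_map.
apply/cl_leP => l; exists m; apply: lesim1_trans _ h.
by apply: mxinf_map_lesim1; exact: (xz n).2.
Qed.

(** T has suprema of increasing sequences only, so this least upper bound is taken
    along a way-below sequence with supremum x, whose values are cofinal. *)
Lemma extension_ex (x : LL) : exists t : T,
  (forall p, way_below (in_limit p) x -> in_target p <=p t) /\
  forall t', (forall p, way_below (in_limit p) x -> in_target p <=p t') -> t <=p t'.
Proof.
have [p [pS px]] := Lambda_approx x.
have pI : increasing (fun n => in_limit (p n)).
  by apply: increasingS => n; exact/way_belowW/pS.
have [|t [pt tP]] := @Cu_O1 _ (SCu_Cu (SCu_cocone_object fT)) (fun n => in_target (p n)).
  by move=> m n /pI; exact: cocone_le.
exists t; split=> [q /(_ _ _ pI px (@pom_refl _ _))[n /cocone_le qn]|t' t'P].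
  exact: pom_trans qn (pt n).
by apply: tP => n; apply: t'P; apply: way_below_le (@pom_refl _ _) (pS n) (px.1 _).
Qed.

Definition extension (x : LL) : T := sval (cid (extension_ex x)).

Lemma extension_least x t :
  (forall p, way_below (in_limit p) x -> in_target p <=p t) -> extension x <=p t.
Proof. by rewrite /extension; case: cid => /= s [_]; apply. Qed.

Lemma extension_ge_way_below x p :
  way_below (in_limit p) x -> in_target p <=p extension x.
Proof. by rewrite /extension; case: cid => /= s [sP _]; exact: sP. Qed.

Lemma stage_sup i (u : Lambda_pomon (D i)) :
  exists z : nat -> Lambda_pomon (D i), [/\ forall n, way_below (z n) (z n.+1),
    is_sup z u, is_sup (fun n => in_limit (at_stage (z n))) (in_limit (at_stage u))
    & is_sup (fun n => in_target (at_stage (z n))) (in_target (at_stage u))].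
Proof.
have [z [zS zu]] := Cu_O2 (Lambda_Cu (@Ddense i)) u.
have zI : increasing z by apply: increasingS => n; exact/way_belowW/zS.
have fzu := Cu_mor_sup (fmor i) zI zu.
exists z; split=> //.
exact: (Lambda_map_sup (psi i) zI zu).
Qed.

Lemma extension_ge x p : in_limit p <=p x -> in_target p <=p extension x.
Proof.
case: p => i u ux; have [z [zS zu _ [_]]] := stage_sup u; apply=> n.
apply: extension_ge_way_below.
have psi_wb := Cu_mor_way_below (SCu_mor_Cu (Lambda_map_SCu (psi i) (@Ddense i))).
apply: way_below_le (@pom_refl _ _) (psi_wb _ _ (zS n)) _.
exact: pom_trans (Lambda_map_le (psi i) (zu.1 n.+1)) ux.
Qed.

Lemma extension_in_limit p : extension (in_limit p) = in_target p.
Proof.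
apply: pom_anti; last exact/extension_ge/pom_refl.
by apply: extension_least => q /way_belowW/cocone_le.
Qed.

Lemma extension_le x y : x <=p y -> extension x <=p extension y.
Proof.
move=> xy; apply: extension_least => p px; apply: extension_ge_way_below.
exact: way_below_le (@pom_refl _ _) px xy.
Qed.

Lemma extension_sup z x : increasing z -> is_sup z x ->
  is_sup (extension \o z) (extension x).
Proof.
move=> zI zx; split=> [n|t zt]; first exact/extension_le/(zx.1 n).
apply: extension_least => p /(_ _ _ zI zx (@pom_refl _ _))[n /extension_ge pn].
exact: pom_trans pn (zt n).
Qed.

(** Approximation from the stages is used twice: x << y puts x way below the image of
    some u of stage i lying below y, hence below the image of some z m << z m.+1 << u,
    and f i preserves the way-below relation. *)
Lemma extension_way_below x y : way_below x y -> way_below (extension x) (extension y).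
Proof.
have [p [pS py]] := Lambda_approx y => xy.
have pI : increasing (fun n => in_limit (p n)).
  by apply: increasingS => n; exact/way_belowW/pS.
have [n xp] := xy _ _ pI py (@pom_refl _ _).
have {xp xy} : way_below x (in_limit (p n.+1)).
  by apply: way_below_le xp (pS n) (@pom_refl _ _).
have : in_limit (p n.+1) <=p y := py.1 _.
case: (p n.+1) => i u uy xu; have [z [zS zu zL zT]] := stage_sup u.
have zI : increasing z by apply: increasingS => k; exact/way_belowW/zS.
have [m xz] :=
  xu _ _ (fun j k jk => Lambda_map_le (psi i) (zI j k jk)) zL (@pom_refl _ _).
apply: way_below_le (Cu_mor_way_below (fmor i) (zS m)) _.
  by have := extension_le xz; rewrite (extension_in_limit (at_stage (z m))).
exact: pom_trans (zT.1 m.+1) (extension_ge uy).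
Qed.

Lemma in_target_approx x : exists p : nat -> stage,
  [/\ increasing (fun n => in_limit (p n)), is_sup (fun n => in_limit (p n)) x,
     increasing (fun n => in_target (p n))
   & is_sup (fun n => in_target (p n)) (extension x)].
Proof.
have [p [pS px]] := Lambda_approx x.
have pI : increasing (fun n => in_limit (p n)).
  by apply: increasingS => n; exact/way_belowW/pS.
exists p; split=> //; first by move=> m n /pI/cocone_le.
have -> : (fun n => in_target (p n)) = extension \o (fun n => in_limit (p n)).
  by apply/funext => n; rewrite /= extension_in_limit.
exact: extension_sup.
Qed.

Lemma extensionD : {morph extension : x y / x + y}.
Proof.
move=> x y; have [p [pI px pTI pT]] := in_target_approx x.
have [q [qI qy qTI qT]] := in_target_approx y.
have xyL := Cu_O4 (Lambda_Cu (limit_dense Idirected psiL Ddense)) pI qI px qy.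
have xyT := Cu_O4 (SCu_Cu (SCu_cocone_object fT)) pTI qTI pT qT.
have sumI : increasing (fun n => in_limit (p n) + in_limit (q n)).
  by move=> m n mn; apply: pom_leD; [exact: pI|exact: qI].
apply: is_sup_unique (extension_sup sumI xyL) _.
suff -> : extension \o (fun n => in_limit (p n) + in_limit (q n)) =
  fun n => in_target (p n) + in_target (q n) by [].
apply/funext => n /=; case: (p n) (q n) => [i u] [j v].
have [_ /(_ i j)[k [ik jk]]] := Idirected.
set u' := Lambda_map (rsys_map D ik) u; set v' := Lambda_map (rsys_map D jk) v.
transitivity (extension (in_limit (at_stage (u' + v' : Lambda_pomon (D k))))).
  by rewrite /in_limit /= Lambda_mapD !Lambda_map_comp.
rewrite extension_in_limit /in_target /= (cocone_step ik) (cocone_step jk).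
exact: (Cu_mor_monoid (fmor k)).2.
Qed.

Lemma extension0 : extension 0 = 0.
Proof.
apply: pom_anti; last exact: pom_ge0.
have [[i _] _] := Idirected.
have -> : 0 = in_limit (at_stage (0 : Lambda_pomon (D i))).
  by rewrite /in_limit /= Lambda_map0.
rewrite extension_in_limit /in_target /= [X in X <=p _](Cu_mor_monoid (fmor i)).1.
exact: pom_refl.
Qed.

Lemma extension_Cu : Cu_morphism extension.
Proof.
split.
- by split; [exact: extension0|exact: extensionD].
- exact: extension_le.
- exact: extension_way_below.
- exact: extension_sup.
Qed.

Hypothesis Dnormal : forall i, left_normal (D i).

(** Take left_normal_calS over some D i for lifts of a = x n.+1 x n, b = x n.+1 y n
    and c = y n.+1 x n.+2.  Then x n lies below d 0 because x n = y n a and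
    a = d 0 a, and d k lies below x n.+2 because d k = c d k. *)
Lemma calS_approx (x : tseq L) : calS x -> exists p : nat -> {i & tseq (D i)},
  forall n, [/\ calS (tagged (p n)),
    lesim1 (x n) (mxinf_map (psi (tag (p n))) (tagged (p n) 0%N))
    & forall k, lesim1 (mxinf_map (psi (tag (p n))) (tagged (p n) k)) (x n.+2)].
Proof.
move=> /choice[y xE].
suff /choice[p pP] n : exists p : {i & tseq (D i)}, [/\ calS (tagged p),
    lesim1 (x n) (mxinf_map (psi (tag p)) (tagged p 0%N))
    & forall k, lesim1 (mxinf_map (psi (tag p)) (tagged p k)) (x n.+2)].
  by exists p.
have [||i [a [b [c [[aE bE cE] [ab bc]]]]]] := @unit_chain_lift _ _ _ _ psi Idirected psiL
  (x n.+1 *i x n) (x n.+1 *i y n) (y n.+1 *i x n.+2).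
- by rewrite -mxinf_mulA [y n *i _]mxinf_mulA -xE.
- by rewrite mxinf_mulA -xE.
have [d [dS ad cd]] := left_normal_calS (@Dnormal i) ab bc.
exists (Tagged (fun i => tseq (D i)) d); split=> //= [|k].
  exists (y n), (x n.+1 *i x n).
  by rewrite -aE -mxinf_mulA -mxinf_mapM -ad aE mxinf_mulA -xE.
by rewrite cd mxinf_mapM cE; exists (y n.+1), (mxinf_map (psi i) (d k)).
Qed.

Lemma extension_LambdaS x : LambdaS x -> scu_W T (extension x).
Proof.
move=> [X XS <-]; have [p pP] := calS_approx XS.
(* the approximants reach two entries further, hence only even indices *)
have X2 n : lesim1 (X n.*2) (X n.+1.*2) by apply: tseq_lt; rewrite ltn_double.
pose X' := TSeq X2.
have XX' : cl X = cl X'.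
  apply: (@pom_anti LL); apply/cl_leP => n.
    by exists n.+1; apply: tseq_lt; lia.
  by exists n.+1.*2; exact: tseq_lt; rewrite ltn_double.
pose q n := at_stage (cl (tagged (p n.*2))).
have X'q : interleaves X' (fun n => tseq_map (psi (tag (p n.*2))) (tagged (p n.*2))).
  by move=> n; have [_] := pP n.*2.
have qE : (fun n => in_limit (q n)) =
    fun n => cl (tseq_map (psi (tag (p n.*2))) (tagged (p n.*2))).
  by apply/funext => n; exact: cl_map.
have qI : increasing (fun n => in_limit (q n)).
  by rewrite qE; exact: interleaves_increasing X'q.
have qX : is_sup (fun n => in_limit (q n)) (cl X').
  by rewrite qE; exact: interleaves_sup X'q.
have eqI : increasing (extension \o (fun n => in_limit (q n))).
  by move=> m n /qI/extension_le.
have eqX := extension_sup qI qX.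
rewrite [\pi_(_) X]XX'.
apply: (SCu_W_sup (SCu_cocone_object fT)) (increasing_weakly eqI eqX) eqX => n.
rewrite /= extension_in_limit.
have [pS _ _] := pP n.*2.
apply: (SCu_mor_W (SCu_cocone_morphism fT (tag (p n.*2)))).
by exists (cl (tagged (p n.*2))) => //; exact: calS_LambdaS.
Qed.

End Cocone.

Lemma extension_unique (T : SCuPair) (g g' : SCu L -> T) :
  SCu_morphism g -> SCu_morphism g' ->
  (forall p, g (in_limit p) = g' (in_limit p)) -> g =1 g'.
Proof.
move=> gM g'M gg' x; have [p [pS px]] := Lambda_approx x.
have pI : increasing (fun n => in_limit (p n)).
  by apply: increasingS => n; exact/way_belowW/pS.
have gx := Cu_mor_sup (SCu_mor_Cu gM) pI px.
have g'x := Cu_mor_sup (SCu_mor_Cu g'M) pI px.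
apply: is_sup_unique gx _; congr is_sup: g'x.
by apply/funext => n; rewrite /= gg'.
Qed.

End UniversalProperty.

Lemma SCu_id (P : SCuPair) : SCu_morphism (@id P).
Proof.
split; last by move=> _ [x Px <-].
by split=> //; split.
Qed.

Lemma SCu_comp (P Q T : SCuPair) (g : Q -> T) (f : P -> Q) :
  SCu_morphism g -> SCu_morphism f -> SCu_morphism (g \o f).
Proof.
move=> [gC gW] [fC fW]; split; last first.
  by move=> _ [x Px <-]; apply: gW; exists (f x) => //; apply: fW; exists x.
split.
- split=> [|x y] /=; first by rewrite (Cu_mor_monoid fC).1 (Cu_mor_monoid gC).1.
  by rewrite (Cu_mor_monoid fC).2 (Cu_mor_monoid gC).2.
- by move=> x y /(Cu_mor_le fC)/(Cu_mor_le gC).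
- by move=> x y /(Cu_mor_way_below fC)/(Cu_mor_way_below gC).
- move=> z s zI zs; apply: (Cu_mor_sup gC) (Cu_mor_sup fC zI zs).
  by move=> m n /zI/(Cu_mor_le fC).
Qed.

Lemma SCu_limit_unique (disp : Order.disp_t) (I : preorderType disp) (D : SCuSystem I)
    (C C' : SCuPair) (iota : forall i, D i -> C) (iota' : forall i, D i -> C') :
  SCu_direct_limit iota -> SCu_direct_limit iota' ->
  exists f : C -> C', SCu_iso f /\ forall i, f \o iota i =1 iota' i.
Proof.
move=> [_ iC iU] [_ iC' iU'].
have [[f [fM fE]] _] := iU _ _ iC'; have [[g [gM gE]] _] := iU' _ _ iC.
exists f; split=> //; split=> //; exists g => //; split.
  apply: (iU _ _ iC).2 => // [||i x]; [exact: SCu_comp|exact: SCu_id|].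
  by rewrite /= [f _]fE [g _]gE.
apply: (iU' _ _ iC').2 => // [||i x]; [exact: SCu_comp|exact: SCu_id|].
by rewrite /= [g _]gE [f _]fE.
Qed.

Lemma SCu_system_direct (disp : Order.disp_t) (I : preorderType disp) (D : rngSystem I) :
  (forall i, dense_rng (D i)) -> SCu_direct_system (SCu_system D).
Proof.
move=> Ddense; split=> [i|i j ij|i ii|i j k ij jk ik].
- exact/SCu_SCu_object/Ddense.
- exact/Lambda_map_SCu/Ddense.
- elim/cl_ind=> x; apply: cl_map_eq => n; apply: mxinfP => k l.
  exact: rsys_id.
- elim/cl_ind=> x; rewrite [RHS]cl_map [LHS]/= [X in Lambda_map _ X]cl_map.
  apply: cl_map_eq => n; exact: Phi_comp.
Qed.

Lemma SCu_limit (disp : Order.disp_t) (I : preorderType disp) (D : rngSystem I)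
    (L : rngType) (psi : forall i, rngHom (D i) L) :
  directed I -> (forall i, dense_rng (D i)) -> (forall i, left_normal (D i)) ->
  rng_direct_limit psi ->
  SCu_direct_limit (D := SCu_system D) (C := SCu L) (fun i => Lambda_map (psi i)).
Proof.
move=> Idir Ddense Dnormal psiL; split; first exact: SCu_system_direct.
  split=> [|i|i j ij u]; first exact/SCu_SCu_object/(limit_dense Idir psiL Ddense).
    exact/Lambda_map_SCu/Ddense.
  exact: Lambda_map_comp.
move=> T f fT; split=> [|g g' gM g'M gE g'E].
  exists (extension Idir psiL Ddense fT); split.
    split; first exact: extension_Cu.
    by move=> _ [x xS <-]; exact: extension_LambdaS.
  by move=> i u; exact: (extension_in_limit Idir psiL Ddense fT (at_stage u)).
apply: (extension_unique Idir psiL Ddense gM g'M) => -[i u].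
exact: etrans (gE i u) (esym (g'E i u)).
Qed.

Theorem theoremD (disp : Order.disp_t) (Omega : preorderType disp)
    (D : rngSystem Omega) (L : rngType) (psi : forall l : Omega, rngHom (D l) L) :
  directed Omega ->
  (forall l : Omega, dense_rng (D l)) ->
  (forall l : Omega, left_normal (D l)) ->
  rng_direct_limit psi ->
  [/\ dense_rng L,
      SCu_object (SCu L),
      exists (C : SCuPair) (iota : forall l : Omega, SCu_system D l -> C),
        SCu_direct_limit iota
    & forall (C : SCuPair) (iota : forall l : Omega, SCu_system D l -> C),
        SCu_direct_limit iota ->
        exists f : C -> SCu L,
          SCu_iso f /\ forall l : Omega, f \o iota l =1 Lambda_map (psi l)].
Proof.
move=> Odir Ddense Dnormal psiL.
have Ldense := limit_dense Odir psiL Ddense.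
have Llim := SCu_limit Odir Ddense Dnormal psiL.
split=> //; first exact: SCu_SCu_object.
  by exists (SCu L), (fun l => Lambda_map (psi l)).
by move=> C iota /SCu_limit_unique/(_ Llim).
Qed.
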